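(* For every kind of preferences $\mathsf{pref}\in\{\mathsf{ct},\mathsf{pca},\mathsf{ppca}\}$, the following decision problem is in $\mathsf{PTIME}$: given a resource contribution game $G$ with endowments as bags of atomic resources (RCGBAR) and a profile $P\in\mathsf{ch}(G)$, decide whether $P\in\mathsf{NE}^{\mathsf{pref}}(G)$.
   Context: Resources. Let $Res$ be a set of atomic resource types. A resource bundle is a finite multiset over $Res$; $\lambda$ is the empty bundle, $A_1\bullet\cdots\bullet A_k$ is the bundle consisting of the instances $A_1,\dots,A_k$, and $B\bullet B'$ is the multiset sum of bundles $B,B'$. For a bundle $B$, $\flat(B)$ is its multiset of atomic resource instances. A resource bag is a finite multiset of resource bundles; for a bag $X=\{B_1,\dots,B_k\}$, $\flat^\bullet(X)=\flat(B_1)\uplus\dots\uplus\flat(B_k)$ (multiset sum). A bag $X$ can be transformed into a bundle $B$, written $X\rightsquigarrow B$, iff $\flat(B)\subseteq\flat^\bullet(X)$ (multiset inclusion). For bundles $B,B'$, $B_{\mid B'}$ is the bundle in which each atomic resource $x$ has the multiplicity it has in $B$ if $x$ occurs in $B'$, and multiplicity $0$ otherwise. Games. A resource contribution game (RCG) is $G=(N,\gamma_1,\dots,\gamma_n,\epsilon_1,\dots,\epsilon_n)$ with $N=\{1,\dots,n\}$ a finite set of players, $\gamma_i$ a resource bundle (goal of $i$), $\epsilon_i$ a finite resource bag (endowment of $i$). It is an RCGBAR iff for every $i\in N$ every element of $\epsilon_i$ is an atomic resource (a bundle consisting of a single instance of an element of $Res$). The choices of $i$ are $\mathsf{ch}_i(G)=\{C\mid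 C\subseteq\epsilon_i\}$ (sub-multisets), the profiles are $\mathsf{ch}(G)=\prod_{i\in N}\mathsf{ch}_i(G)$, and the outcome of $P=(P_1,\dots,P_n)$ is the bag $\mathsf{out}(P)=P_1\uplus\dots\uplus P_n$. $(P_{-i},P_i')$ is $P$ with $P_i$ replaced by $P'_i$. Satisfaction and contention. Player $i$ is potentially satisfied in $P$ iff $\mathsf{out}(P)\rightsquigarrow\gamma_i$. Let $\{s_1,\dots,s_k\}$ be the set of players potentially satisfied in $P$. $P$ is contentious iff $\mathsf{out}(P)\not\rightsquigarrow\gamma_{s_1}\bullet\dots\bullet\gamma_{s_k}$. $P$ is contentious for $i$ iff $i$ is potentially satisfied in $P$ and $\mathsf{out}(P)\not\rightsquigarrow{\gamma_{s_1}}_{\mid\gamma_i}\bullet\dots\bullet{\gamma_{s_k}}_{\mid\gamma_i}$. Preferences. $P$ is good for $i$ according to $\mathsf{ct}$ (contention-tolerant) iff $i$ is potentially satisfied in $P$; according to $\mathsf{pca}$ (public contention-averse) iff $i$ is potentially satisfied in $P$ and $P$ is not contentious; according to $\mathsf{ppca}$ (private contention-averse) iff $i$ is potentially satisfied in $P$ and $P$ is not contentious for $i$. Player $i$ strictly prefers $P$ over $Q$ (written $Q\prec_i^{\mathsf{pref}}P$) iff one of: (1) neither $P$ nor $Q$ is good for $i$ and $P_i\subset Q_i$ (strict multiset inclusion); (2) $P$ is good for $i$ and $Q$ is not; (3) both are good for $i$ and $P_i\subset Q_i$. $P$ is a (pure) Nash equilibrium according to $\mathsf{pref}$ iff there are no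 $i\in N$ and $P'_i\in\mathsf{ch}_i(G)$ with $P\prec_i^{\mathsf{pref}}(P_{-i},P'_i)$; $\mathsf{NE}^{\mathsf{pref}}(G)$ is the set of these. Encoding. Multisets are given by listing their elements with repetition; the atomic resource types are part of the input. *)

(* Defs.v *)
(* MathComp, with the finite multisets of mathcomp-finmap. *)
From mathcomp Require Import all_boot.
From mathcomp Require Export finmap multiset.

Set Implicit Arguments.
Unset Strict Implicit.
Unset Printing Implicit Defensive.

Local Open Scope mset_scope.

Inductive direction := MoveLeft | Stay | MoveRight.

(* Deterministic Turing machine with input alphabet Sigma and finitely many
   two-way infinite tapes.  A cell holds None (blank) or Some of an input symbol
   or of an auxiliary symbol.  The machine stops in the states q such that
   verdict q = Some b, accepting if b = true and rejecting if b = false. *)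
Record machine (Sigma : finType) := Machine {
  work_tapes : nat;
  state : finType;
  auxiliary : finType;
  start : state;
  verdict : state -> option bool;
  transition :
    state -> {ffun 'I_work_tapes.+1 -> option (Sigma + auxiliary)} ->
    state * ('I_work_tapes.+1 -> option (Sigma + auxiliary) * direction)
}.

Section Execution.
Variables (Sigma : finType) (M : machine Sigma).

Definition cell : finType := option (Sigma + auxiliary M).

(* The cells to the left of the head, nearest first, and the cells from the head
   on; all the cells that are not listed are blank. *)
Record tape := Tape { before : seq cell; from_head : seq cell }.

Definition scanned (T : tape) : cell := head None (from_head T).

Definition write_move (T : tape) (a : cell * direction) : tape :=
  let: Tape l r := T in
  let: (x, dir) := a in
  match dir with
  | MoveLeft => Tape (behead l) (head None l :: x :: behead r)
  | Stay => Tape l (x :: behead r)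
  | MoveRight => Tape (x :: l) (behead r)
  end.

Definition configuration :=
  (state M * {ffun 'I_(work_tapes M).+1 -> tape})%type.

Definition initial (w : seq Sigma) : configuration :=
  (start M,
   [ffun j => Tape [::] (if j == ord0 then [seq Some (inl x) | x <- w]
                         else [::])]).

Definition step (c : configuration) : configuration :=
  let: (q, tapes) := c in
  if verdict q is Some _ then c else
  let: (q', act) := transition q [ffun j => scanned (tapes j)] in
  (q', [ffun j => write_move (tapes j) (act j)]).

Definition verdict_after (w : seq Sigma) (t : nat) : option bool :=
  verdict (iter t step (initial w)).1.

End Execution.

Definition PTIME (Sigma : finType) (L : seq Sigma -> Prop) : Prop :=
  exists (M : machine Sigma) (c k : nat), forall w : seq Sigma,
    exists2 t, t <= c * size w ^ k + c &
      (L w -> verdict_after M w t = Some true) /\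
      (~ L w -> verdict_after M w t = Some false).

Notation bundle Res := {mset Res}.
Notation bag Res := {mset {mset Res}}.

Section Games.
Variable Res : choiceType.

Definition flat_bag (X : bag Res) : {mset Res} := \big[msetD/mset0]_(B <- X) B.

Definition transforms (X : bag Res) (B : bundle Res) : bool := B `<=` flat_bag X.

(* B_{|B'} *)
Definition restrict (B B' : bundle Res) : bundle Res :=
  [fsfun r in finsupp B' => B r].

Record RCG (n : nat) := Game {
  goal : 'I_n -> bundle Res;
  endowment : 'I_n -> bag Res
}.

Section Play.
Variables (n : nat) (G : RCG n).

Definition is_RCGBAR : Prop :=
  forall (i : 'I_n) (B : bundle Res),
    B \in endowment G i -> exists r : Res, B = [mset r].

Implicit Types (P Q : 'I_n -> bag Res) (i : 'I_n).

Definition is_profile P : Prop := forall i, P i `<=` endowment G i.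

Definition outcome P : bag Res := \big[msetD/mset0]_i P i.

Definition potentially_satisfied P i : bool :=
  transforms (outcome P) (goal G i).

Definition contentious P : bool :=
  ~~ transforms (outcome P)
       (\big[msetD/mset0]_(s | potentially_satisfied P s) goal G s).

Definition contentious_for P i : bool :=
  potentially_satisfied P i &&
  ~~ transforms (outcome P)
       (\big[msetD/mset0]_(s | potentially_satisfied P s)
          restrict (goal G s) (goal G i)).

End Play.
End Games.

Variant preference := ct | pca | ppca.

Section Equilibria.
Variables (Res : choiceType) (n : nat) (G : RCG Res n) (pref : preference).
Implicit Types (P Q : 'I_n -> bag Res) (i : 'I_n).

Definition good P i : bool :=
  match pref with
  | ct => potentially_satisfied G P i
  | pca => potentially_satisfied G P i && ~~ contentious G P
  | ppca => potentially_satisfied G P i && ~~ contentious_for G P i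
  end.

Definition strictly_prefers i P Q : bool :=
  [|| [&& ~~ good P i, ~~ good Q i & P i `<` Q i],
      good P i && ~~ good Q i
    | [&& good P i, good Q i & P i `<` Q i]].

Definition deviate P i (C : bag Res) : 'I_n -> bag Res :=
  fun j => if j == i then C else P j.

Definition is_NE P : Prop :=
  is_profile G P /\
  ~ exists i (C : bag Res),
      C `<=` endowment G i /\ strictly_prefers i (deviate P i C) P.

End Equilibria.

(* A written instance.  The atomic resource types are part of it: they are given
   by their names, which are arbitrary bit strings.  Multisets are given by
   listing their elements, with repetition, in an arbitrary order. *)
Record instance := Instance {
  types : seq bitseq;
  players : nat;
  game_list :
    players.-tuple (seq (seq_sub types) * seq (seq (seq_sub types)));
  profile_list : players.-tuple (seq (seq (seq_sub types)))
}.

Definition bag_of (Res : choiceType) (s : seq (seq Res)) : bag Res :=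
  seq_mset [seq seq_mset b | b <- s].

Definition game_of (d : instance) : RCG (seq_sub (types d)) (players d) :=
  Game (fun i => seq_mset (tnth (game_list d) i).1)
       (fun i => bag_of (tnth (game_list d) i).2).

Definition profile_of (d : instance) (i : 'I_(players d)) :
    bag (seq_sub (types d)) :=
  bag_of (tnth (profile_list d) i).

(* Two bits, inl false and inl true, and two brackets, inr true (opening) and
   inr false (closing). *)
Definition symbol : finType := (bool + bool)%type.

Definition bracket (w : seq symbol) : seq symbol :=
  inr true :: rcons w (inr false).

Definition enc_list (T : Type) (enc : T -> seq symbol) (s : seq T) :
    seq symbol :=
  bracket (flatten [seq enc x | x <- s]).

Definition enc_name (b : bitseq) : seq symbol :=
  bracket [seq inl x | x <- b].

Definition enc_bundle (ts : seq bitseq) : seq (seq_sub ts) -> seq symbol :=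
  enc_list (fun r => enc_name (val r)).

Definition enc_bag (ts : seq bitseq) : seq (seq (seq_sub ts)) -> seq symbol :=
  enc_list (@enc_bundle ts).

Definition enc_instance (d : instance) : seq symbol :=
  enc_list enc_name (types d) ++
  enc_list (fun p => bracket (enc_bundle p.1 ++ enc_bag p.2)) (game_list d) ++
  enc_list (@enc_bag (types d)) (profile_list d).

(* The words that do not encode an RCGBAR with a profile are not in the
   language. *)
Definition NE_checking (pref : preference) (w : seq symbol) : Prop :=
  exists d : instance,
    [/\ w = enc_instance d,
        is_RCGBAR (game_of d),
        is_profile (game_of d) (@profile_of d) &
        is_NE (game_of d) pref (@profile_of d)].

(* Main.v *)
Require Import Defs.
From mathcomp Require Import all_boot.
From mathcomp Require Import zify.

Set Implicit Arguments.
Unset Strict Implicit.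
Unset Printing Implicit Defensive.

Local Open Scope mset_scope.

(* With atomic endowments only the total supply of each resource matters.  Let o
   be what the others supply and suppose that i contributes up to e.  A good
   contribution must provide the goal of i and, for the resources on which
   contention matters to i, the joint claims of all the players that are
   satisfied as a result.  These requirements are monotone in the set of
   satisfied players, so that iterating them at most n times from the empty set
   gives the least supply that is good for i: a good contribution exists iff this
   supply is at most o + e, although being good is not monotone.  A profile that
   is bad for i is stable iff i contributes nothing and no good contribution
   exists; a profile that is good for i is stable iff i contributes nothing that
   exceeds the least good supply.

   Polynomial time is obtained from a class of functions on S-expressions, kept in
   Polish notation on a stack of a Turing machine, which is closed under
   composition, case analysis and folds whose steps enlarge the accumulator by a
   polynomial in the fixed data.  A word is decoded without error checking, and
   encoding the result again detects the words that are not instances. *)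

(** * Structured stack programs on Turing machines *)

(** Being good is not monotone because a larger supply may satisfy a further player, whose claims
    must then be met too. The least supply works for two reasons: a good supply satisfies every
    player met in the iteration, so it meets the requirements of each stage; and at the fixed point
    the satisfied players are exactly those whose claims were counted, so the least supply is itself
    good. If a good profile exceeds it in a resource that i contributes, withdrawing one instance
    need not give a good profile, but some good contribution lies below the reduced one.

    On the machine side the obstacle is the fold: a polynomial-time step that doubles its
    accumulator becomes exponential when iterated, hence the additive restriction on growth.
    Moreover, the resource type of a game depends on the instance, while a program computes one
    function on a fixed type. The procedure therefore works on names, and its verdict is shown to be
    invariant under injective renaming. *)

Section Programs.
Variables Sigma aux : finType.

Definition letter : finType := (Sigma + aux)%type.

Inductive reg := In | Main | Aux | Tmp.

Record store := Store {
  in_stack : seq letter;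
  main_stack : seq letter;
  aux_stack : seq letter;
  tmp_stack : seq letter
}.

Definition get (s : store) (r : reg) : seq letter :=
  match r with
  | In => in_stack s
  | Main => main_stack s
  | Aux => aux_stack s
  | Tmp => tmp_stack s
  end.

Definition put (s : store) (r : reg) (v : seq letter) : store :=
  let: Store i m a t := s in
  match r with
  | In => Store v m a t
  | Main => Store i v a t
  | Aux => Store i m v t
  | Tmp => Store i m a v
  end.

Definition top (s : store) (r : reg) : option letter := ohead (get s r).

Inductive prog :=
| Push of reg & reg & (option letter -> letter)
| Pop of reg
| Seq of prog & prog
| If of reg & pred (option letter) & prog & prog
| While of reg & pred (option letter) & prog.

(* [exec p s s' t]: started on [s], the program [p] stops on [s'] within [t]
   steps of the compiled Turing machine. *)
Inductive exec : prog -> store -> store -> nat -> Prop :=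
| exec_push r src g s :
    exec (Push r src g) s (put s r (g (top s src) :: get s r)) 2
| exec_pop r s : exec (Pop r) s (put s r (behead (get s r))) 1
| exec_seq p q s1 s2 s3 t1 t2 :
    exec p s1 s2 t1 -> exec q s2 s3 t2 -> exec (Seq p q) s1 s3 (t1 + t2)
| exec_if r (b : pred (option letter)) p q s s' t :
    exec (if b (top s r) then p else q) s s' t -> exec (If r b p q) s s' t.+1
| exec_while_stop r (b : pred (option letter)) p s : ~~ b (top s r) -> exec (While r b p) s s 1
| exec_while_go r (b : pred (option letter)) p s1 s2 s3 t1 t2 :
    b (top s1 r) -> exec p s1 s2 t1 -> exec (While r b p) s2 s3 t2 ->
    exec (While r b p) s1 s3 (t1 + t2).+1
| exec_le p s s' t t' : exec p s s' t -> t <= t' -> exec p s s' t'.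

(** [Push] needs two control points: the head stands on the top symbol and must first move to the
    blank cell on its left. The symbol to write is computed before the move and kept in the
    location, since the source may be the same stack. The additional [None] of [If] and [While] is
    the test. *)
Fixpoint location (p : prog) : finType :=
  match p with
  | Push _ _ _ => option letter
  | Pop _ => unit
  | Seq p q => (location p + location q)%type
  | If _ _ p q => option (location p + location q)
  | While _ _ p => option (location p)
  end.

Fixpoint entry (p : prog) : location p :=
  match p with
  | Push _ _ _ => None
  | Pop _ => tt
  | Seq p q => inl (entry p)
  | If _ _ p q => None
  | While _ _ p => None
  end.

Definition same_reg (r r' : reg) : bool :=
  match r, r' with
  | In, In | Main, Main | Aux, Aux | Tmp, Tmp => true
  | _, _ => false
  end.

Definition action := reg -> option letter * direction.

Definition act_on (r : reg) (a : option letter * direction)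
    (h : reg -> option letter) : action :=
  fun r' => if same_reg r r' then a else (h r', Stay).

Definition idle (h : reg -> option letter) : action := fun r => (h r, Stay).

(* Leaving the program is represented by the next location [None]. *)
Fixpoint trans (p : prog) :
    location p -> (reg -> option letter) -> option (location p) * action :=
  match p return location p -> _ -> option (location p) * action with
  | Push r src g => fun l h =>
      if l is Some x then (None, act_on r (Some x, Stay) h)
      else (Some (Some (g (h src))), act_on r (h r, MoveLeft) h)
  | Pop r => fun _ h => (None, act_on r (None, MoveRight) h)
  | Seq p q => fun l h =>
      match l with
      | inl l => let: (o, a) := trans l h in
                 (Some (if o is Some l' then inl l' else inr (entry q)), a)
      | inr l => let: (o, a) := trans l h in (omap inr o, a)
      end
  | If r b p q => fun l h =>
      match l with
      | None => (Some (Some (if b (h r) then inl (entry p) else inr (entry q))),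
                 idle h)
      | Some (inl l) => let: (o, a) := trans l h in (omap (Some \o inl) o, a)
      | Some (inr l) => let: (o, a) := trans l h in (omap (Some \o inr) o, a)
      end
  | While r b p => fun l h =>
      if l is Some l then let: (o, a) := trans l h in (Some o, a)
      else (if b (h r) then Some (Some (entry p)) else None, idle h)
  end.

Definition tape_of_reg (r : reg) : 'I_4 :=
  match r with
  | In => @Ordinal 4 0 isT
  | Main => @Ordinal 4 1 isT
  | Aux => @Ordinal 4 2 isT
  | Tmp => @Ordinal 4 3 isT
  end.

Definition reg_of_tape (j : 'I_4) : reg := nth Tmp [:: In; Main; Aux] j.

Lemma tape_of_regK r : reg_of_tape (tape_of_reg r) = r.
Proof. by case: r. Qed.

Variables (p0 : prog) (accepts : pred (option letter)).

(** [inr None] is reached when the program exits; it has no verdict yet, and its only step tests the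
    top of [Main]. *)
Definition machine_of : machine Sigma := {|
  work_tapes := 3;
  state := (location p0 + option bool)%type;
  auxiliary := aux;
  start := inl (entry p0);
  verdict := fun q => if q is inr o then o else None;
  transition := fun q h =>
    match q with
    | inl l =>
        let: (o, a) := trans l (fun r => h (tape_of_reg r)) in
        (if o is Some l' then inl l' else inr None,
         fun j => a (reg_of_tape j))
    | inr _ => (inr (Some (accepts (h (tape_of_reg Main)))),
                fun j => (h j, Stay))
    end
|}.

Local Notation M := machine_of.
Local Notation tapes := {ffun 'I_4 -> tape M}.

Definition perform (T : tapes) (a : action) : tapes :=
  [ffun j => write_move (T j) (a (reg_of_tape j))].

Definition scan (T : tapes) (r : reg) : option letter :=
  [ffun j => scanned (T j)] (tape_of_reg r).

Lemma scanE T r : scan T r = scanned (T (tape_of_reg r)).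
Proof. exact: ffunE. Qed.

(** Runs are an inductive relation rather than iterations of [step], so that a run of a part of a
    program can be replayed inside the whole program. *)
Inductive runs (p : prog) : location p -> tapes -> tapes -> nat -> Prop :=
| runs_exit l T a : trans l (scan T) = (None, a) -> runs l T (perform T a) 1
| runs_next l l' T a T' t : trans l (scan T) = (Some l', a) ->
    runs l' (perform T a) T' t -> runs l T T' t.+1.

Lemma runs_seq p q T1 T2 T3 t1 t2 :
  runs (entry p) T1 T2 t1 -> runs (entry q) T2 T3 t2 ->
  runs (entry (Seq p q)) T1 T3 (t1 + t2).
Proof.
have right l T T' t : runs l T T' t -> @runs (Seq p q) (inr l) T T' t.
  elim=> {l T T' t} [l T a e|l l' T a T' t e _ IH].
    by apply: runs_exit; rewrite /= e.
  by apply: runs_next IH; rewrite /= e.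
move=> /= run1 run2; move: (entry p) T1 T2 t1 run1 run2 => l T1 T2 t1.
elim=> {l T1 T2 t1} [l T a e|l l' T a T' t e _ IH] run2.
  by apply: runs_next (right _ _ _ _ run2); rewrite /= e.
by apply: runs_next (IH run2); rewrite /= e.
Qed.

Lemma runs_if r (b : pred (option letter)) p q T T' t :
  runs (entry (if b (scan T r) then p else q)) (perform T (idle (scan T))) T' t ->
  runs (entry (If r b p q)) T T' t.+1.
Proof.
have left l T1 T2 t1 :
    @runs p l T1 T2 t1 -> @runs (If r b p q) (Some (inl l)) T1 T2 t1.
  elim=> {l T1 T2 t1} [l T1 a e|l l' T1 a T2 t1 e _ IH].
    by apply: runs_exit; rewrite /= e.
  by apply: runs_next IH; rewrite /= e.
have right l T1 T2 t1 :
    @runs q l T1 T2 t1 -> @runs (If r b p q) (Some (inr l)) T1 T2 t1.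
  elim=> {l T1 T2 t1} [l T1 a e|l l' T1 a T2 t1 e _ IH].
    by apply: runs_exit; rewrite /= e.
  by apply: runs_next IH; rewrite /= e.
move=> run; apply: runs_next => [//|].
by case: (b _) run => run; [apply: left | apply: right].
Qed.

Lemma runs_while_stop r (b : pred (option letter)) p T :
  ~~ b (scan T r) -> runs (entry (While r b p)) T (perform T (idle (scan T))) 1.
Proof. by move=> nb; apply: runs_exit; rewrite /= (negbTE nb). Qed.

Lemma runs_while_go r (b : pred (option letter)) p T1 T2 T3 t1 t2 :
  b (scan T1 r) -> runs (entry p) (perform T1 (idle (scan T1))) T2 t1 ->
  runs (entry (While r b p)) T2 T3 t2 ->
  runs (entry (While r b p)) T1 T3 (t1 + t2).+1.
Proof.
move=> bT run1 run2; apply: runs_next => [/=|]; first by rewrite bT.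
elim: run1 run2 => {bT T1 T2 t1} [l T a e|l l' T a T' t e _ IH] run2.
  by apply: runs_next run2; rewrite /= e.
by apply: runs_next (IH run2); rewrite /= e.
Qed.

(** Trailing blanks are allowed because even an idle step on an empty stack writes a blank that is
    then listed in the tape. *)
Definition holds_stack (T : tape M) (s : seq letter) : Prop :=
  all (pred1 None) (before T) /\
  exists k, from_head T = [seq Some x | x <- s] ++ nseq k None.

Lemma scanned_stack T s : holds_stack T s -> scanned T = ohead s.
Proof. by rewrite /scanned => -[_ [k ->]]; case: s => //=; case: k. Qed.

Lemma stack_idle T s : holds_stack T s -> holds_stack (write_move T (scanned T, Stay)) s.
Proof.
case: T => l r [/= al [k ->]]; split=> //=.
case: s => [|x s] /=; last by exists k.
by case: k => [|k] /=; [exists 1 | exists k.+1].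
Qed.

Lemma stack_push T s x : holds_stack T s ->
  holds_stack (write_move (write_move T (scanned T, MoveLeft)) (Some x, Stay)) (x :: s).
Proof.
case: T => l r [/= al [k ->]]; split => /=; first by case: l al => //= y l /andP[].
case: s => [|y s] /=; last by exists k.
by case: k => [|k]; [exists 1 | exists k.+1].
Qed.

Lemma stack_pop T s : holds_stack T s ->
  holds_stack (write_move T (None, MoveRight)) (behead s).
Proof.
case: T => l r [/= al [k ->]]; split => //=.
case: s => [|y s] /=; last by exists k.
by exists k.-1; case: k.
Qed.

Definition holds (T : tapes) (s : store) : Prop :=
  forall r, holds_stack (T (tape_of_reg r)) (get s r).

Lemma scan_holds T s r : holds T s -> scan T r = top s r.
Proof. by rewrite scanE => /(_ r) /scanned_stack. Qed.

Lemma holds_idle T s : holds T s -> holds (perform T (idle (scan T))) s.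
Proof. by move=> H r; rewrite ffunE tape_of_regK /idle scanE; apply: stack_idle. Qed.

Lemma get_put s r r' v :
  get (put s r v) r' = if same_reg r r' then v else get s r'.
Proof. by case: s r r' => ? ? ? ? [] []. Qed.

Lemma same_regP r r' : reflect (r = r') (same_reg r r').
Proof. by case: r r' => [] []; constructor. Qed.

Lemma exec_runs p s s' t T : exec p s s' t -> holds T s ->
  exists T' t', [/\ t' <= t, holds T' s' & runs (entry p) T T' t'].
Proof.
move=> ex; elim: ex T => {p s s' t}
  [r src g s|r s|p q s1 s2 s3 t1 t2 _ IH1 _ IH2|r b p q s s' t _ IH
  |r b p s nb|r b p s1 s2 s3 t1 t2 b1 _ IH1 _ IH2|p s s' t t' _ IH le_t] T H.
- set a1 := act_on r (scan T r, MoveLeft) (scan T).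
  set a2 := act_on r (Some (g (scan T src)), Stay) (scan (perform T a1)).
  exists (perform (perform T a1) a2), 2; split=> //; last first.
    by apply: (@runs_next _ _ _ _ a1); [|apply: runs_exit].
  move=> r'; rewrite get_put ffunE [perform T a1 _]ffunE tape_of_regK /a2 {1}/act_on.
  case: same_regP => [<-|nr].
    rewrite -(scan_holds _ H) /a1 /act_on; case: same_regP => // _.
    by rewrite [scan T r]scanE; apply: stack_push.
  rewrite !scanE ffunE tape_of_regK.
  have -> : a1 r' = (scan T r', Stay) by rewrite /a1 /act_on; case: same_regP.
  rewrite scanE.
  by do 2!apply: stack_idle.
- exists (perform T (act_on r (None, MoveRight) (scan T))), 1; split=> //.
    move=> r'; rewrite get_put !ffunE tape_of_regK /act_on.
    by case: same_regP => [<-|nr]; [apply: stack_pop | rewrite scanE; apply: stack_idle].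
  exact: runs_exit.
- have [T2 [u1 [le1 H2 run1]]] := IH1 _ H.
  have [T3 [u2 [le2 H3 run2]]] := IH2 _ H2.
  exists T3, (u1 + u2); split=> //; first exact: leq_add.
  exact: runs_seq run2.
- have [T2 [u [le_u H2 run]]] := IH _ (holds_idle H).
  exists T2, u.+1; split=> //; apply: runs_if.
  by rewrite (scan_holds _ H).
- exists (perform T (idle (scan T))), 1; split=> //; first exact: holds_idle.
  by apply: runs_while_stop; rewrite (scan_holds _ H).
- have [T2 [u1 [le1 H2 run1]]] := IH1 _ (holds_idle H).
  have [T3 [u2 [le2 H3 run2]]] := IH2 _ H2.
  exists T3, (u1 + u2).+1; split=> //; first by rewrite ltnS leq_add.
  by apply: runs_while_go run2; rewrite ?(scan_holds _ H).
have [T' [u [le_u H' run]]] := IH _ H.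
by exists T', u; split=> //; apply: leq_trans le_t.
Qed.

Lemma runs_iter l T T' t : @runs p0 l T T' t ->
  iter t (@step _ M) (inl l, T) = (inr None, T').
Proof.
elim=> {l T T' t} [l T a e|l l' T a T' t e _ IH]; last rewrite iterSr -IH /=.
  by rewrite /= (_ : trans l _ = (None, a)).
by rewrite (_ : trans l _ = (Some l', a)).
Qed.

(** The additional step is the test in the state [inr None]. *)
Lemma machine_verdict w s' t :
  exec p0 (Store [seq inl x | x <- w] [::] [::] [::]) s' t ->
  exists2 t', t' <= t.+1 & verdict_after M w t' = Some (accepts (top s' Main)).
Proof.
move=> /exec_runs ex; have /ex[T' [t' [le_t H /runs_iter run]]] :
    holds (initial M w).2 (Store [seq inl x | x <- w] [::] [::] [::]).
  move=> r; rewrite ffunE; split; first by [].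
  exists 0; rewrite cats0; case: r => //=.
  by rewrite -map_comp.
exists t'.+1; rewrite // /verdict_after iterS run /=.
by rewrite -(scan_holds _ H).
Qed.
End Programs.

Arguments Pop {Sigma aux} _.

(** * S-expressions on stacks *)

Inductive sexp := Atom of option bool | Pair of sexp & sexp.

Definition stack_symbol : finType := (bool + option bool)%type.

Local Notation symb := (letter symbol stack_symbol).
Local Notation program := (prog symbol stack_symbol).

Definition mark : symb := inr (inl false).
Definition pair_symb : symb := inr (inl true).
Definition atom_symb (o : option bool) : symb := inr (inr o).

(* Polish notation: a pair is built on, or removed from, the top of a stack by
   pushing or popping one symbol. *)
Fixpoint polish (x : sexp) : seq symb :=
  match x with
  | Atom o => [:: atom_symb o]
  | Pair x y => pair_symb :: polish x ++ polish y
  end.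

Definition weight (x : sexp) : nat := size (polish x).

Lemma weight_gt0 x : 0 < weight x.
Proof. by case: x. Qed.

Lemma weight_Pair x y : weight (Pair x y) = (weight x + weight y).+1.
Proof. by rewrite /weight /= size_cat. Qed.

Lemma polish_unmarked x : all (predC1 mark) (polish x).
Proof. by elim: x => [|x IHx y IHy] //=; rewrite all_cat IHx. Qed.

Definition copied (o : option symb) : symb := odflt mark o.
Definition unmarked (o : option symb) : bool := o != Some mark.
Definition is_pair_symb (o : option symb) : bool := o == Some pair_symb.

(* [Tmp] holds one mark for each S-expression that is still to be read. *)
Definition shift_loop : program :=
  While Tmp isSome
    (Seq (If Main is_pair_symb (Push Tmp Tmp (fun=> mark)) (Pop Tmp))
         (Seq (Push Aux Main copied) (Pop Main))).

(** On [Aux] the value lies reversed above a [mark]. As no Polish notation contains [mark], the way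
    back needs no parsing. *)
Definition to_aux : program :=
  Seq (Push Aux Aux (fun=> mark)) (Seq (Push Tmp Tmp (fun=> mark)) shift_loop).

Definition from_aux : program :=
  Seq (While Aux unmarked (Seq (Push Main Aux copied) (Pop Aux))) (Pop Aux).

Definition from_aux_copying : program :=
  Seq (While Aux unmarked
         (Seq (Push Main Aux copied) (Seq (Push Tmp Aux copied) (Pop Aux))))
      (Pop Aux).

Definition tmp_to_aux : program :=
  Seq (Push Aux Aux (fun=> mark))
      (While Tmp isSome (Seq (Push Aux Tmp copied) (Pop Tmp))).

Definition drop_value : program :=
  Seq to_aux (Seq (While Aux unmarked (Pop Aux)) (Pop Aux)).

(** The copy on [Tmp] passes through [Aux] once more, since moving it directly to [Main] would
    reverse it. *)
Definition dup_value : program :=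
  Seq to_aux (Seq from_aux_copying (Seq tmp_to_aux from_aux)).

Lemma exec_weaken (p : program) s s1 s2 t t' :
  exec p s s1 t -> s1 = s2 -> t <= t' -> exec p s s2 t'.
Proof. by move=> ex <-; apply: exec_le. Qed.

(** The run on the remaining [k] values is a hypothesis, so that for a pair the induction hypothesis
    of the second component becomes the continuation of the first. A symbol costs at most 7 steps:
    two tests, two pushes and a pop. *)
Lemma exec_shift_loop x i m a k s' t :
  exec shift_loop (Store i m (rev (polish x) ++ a) (nseq k mark)) s' t ->
  exec shift_loop (Store i (polish x ++ m) a (nseq k.+1 mark)) s' (7 * weight x + t).
Proof.
elim: x i m a k t => [o|x IHx y IHy] i m a k t ex.
  apply: exec_weaken.
  - apply: exec_while_go => //; first apply: exec_seq.
    + by apply: exec_if; apply: exec_pop.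
    + by apply: exec_seq; [apply: exec_push | apply: exec_pop].
    + exact: ex.
  - by [].
  - by rewrite /weight /=; lia.
apply: exec_weaken.
- apply: exec_while_go => //; first apply: exec_seq.
  + by apply: exec_if; apply: exec_push.
  + by apply: exec_seq; [apply: exec_push | apply: exec_pop].
  + rewrite /= -catA; apply: (IHx _ _ (pair_symb :: a) k.+1); apply: IHy.
    rewrite /= rev_cons rev_cat -cats1 -!catA /= in ex.
    exact: ex.
- by [].
- by rewrite weight_Pair; lia.
Qed.

(** The true cost is 7 per symbol plus 5; here and below additive constants are absorbed because
    weights are positive. *)
Lemma exec_to_aux x i m a :
  exec to_aux (Store i (polish x ++ m) a [::])
    (Store i m (rev (polish x) ++ mark :: a) [::]) (12 * weight x).
Proof.
have w0 := weight_gt0 x.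
apply: exec_weaken.
- apply: exec_seq; first exact: exec_push.
  apply: exec_seq; first exact: exec_push.
  by apply: (@exec_shift_loop _ _ _ _ 0); apply: exec_while_stop.
- by [].
- by lia.
Qed.

Lemma exec_from_aux v i m a :
  all (predC1 mark) v ->
  exec from_aux (Store i m (v ++ mark :: a) [::])
    (Store i (rev v ++ m) a [::]) (4 * size v + 2).
Proof.
move=> mv; apply: exec_weaken.
- apply: (@exec_seq _ _ _ _ _ (Store i (rev v ++ m) (mark :: a) [::]) _ (4 * size v + 1));
    last exact: exec_pop.
  elim: v m mv => [|x v IH] m /= => [_|/andP[mx mv]]; first exact: exec_while_stop.
  apply: exec_weaken.
  + apply: exec_while_go => //.
    * by apply: exec_seq; [apply: exec_push | apply: exec_pop].
    * exact: IH.
  + by rewrite rev_cons cat_rcons.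
  + by set n := size v; lia.
- by [].
- by lia.
Qed.

Lemma exec_from_aux_copying v i m a t :
  all (predC1 mark) v ->
  exec from_aux_copying (Store i m (v ++ mark :: a) t)
    (Store i (rev v ++ m) a (rev v ++ t)) (6 * size v + 2).
Proof.
move=> mv; apply: exec_weaken.
- apply: (@exec_seq _ _ _ _ _ (Store i (rev v ++ m) (mark :: a) (rev v ++ t)) _
    (6 * size v + 1)); last exact: exec_pop.
  elim: v m t mv => [|x v IH] m t /= => [_|/andP[mx mv]]; first exact: exec_while_stop.
  apply: exec_weaken.
  + apply: exec_while_go => //.
    * apply: exec_seq; first exact: exec_push.
      by apply: exec_seq; [apply: exec_push | apply: exec_pop].
    * exact: IH.
  + by rewrite rev_cons !cat_rcons.
  + by set n := size v; lia.
- by [].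
- by lia.
Qed.

Lemma exec_tmp_to_aux v i m a :
  exec tmp_to_aux (Store i m a v)
    (Store i m (rev v ++ mark :: a) [::]) (4 * size v + 3).
Proof.
have loop a' : exec (While Tmp isSome (Seq (Push Aux Tmp copied) (Pop Tmp)))
    (Store i m a' v) (Store i m (rev v ++ a') [::]) (4 * size v + 1).
  elim: v a' => [|x v IH] a' /=; first exact: exec_while_stop.
  apply: exec_weaken.
  + apply: exec_while_go => //.
    by apply: exec_seq; [apply: exec_push | apply: exec_pop].
  + by rewrite rev_cons !cat_rcons.
  + by set n := size v; lia.
apply: exec_weaken.
- by apply: exec_seq; [apply: exec_push | apply: loop].
- by [].
- by lia.
Qed.

Lemma exec_drop_value x i m a :
  exec drop_value (Store i (polish x ++ m) a [::]) (Store i m a [::]) (16 * weight x).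
Proof.
have w0 := weight_gt0 x.
apply: exec_weaken.
- apply: exec_seq; first exact: exec_to_aux.
  apply: exec_seq; last exact: exec_pop.
  have: all (predC1 mark) (rev (polish x)) by rewrite all_rev polish_unmarked.
  suff H v : all (predC1 mark) v -> exec (While Aux unmarked (Pop Aux))
      (Store i m (v ++ mark :: a) [::]) (Store i m (mark :: a) [::])
      (2 * size v + 1) by apply: H.
  elim: v => [|y v IH] /= => [_|/andP[my mv]]; first exact: exec_while_stop.
  apply: exec_weaken.
  + by apply: exec_while_go => //; [apply: exec_pop | apply: IH].
  + by [].
  + by set n := size v; lia.
- by [].
- by rewrite size_rev -/(weight x); lia.
Qed.

Lemma exec_return x i m a :
  exec from_aux (Store i m (rev (polish x) ++ mark :: a) [::])
    (Store i (polish x ++ m) a [::]) (6 * weight x).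
Proof.
have w0 := weight_gt0 x.
apply: exec_weaken; first apply: exec_from_aux.
- by rewrite all_rev polish_unmarked.
- by rewrite revK.
- by rewrite size_rev -/(weight x); lia.
Qed.

Lemma exec_dup_value x i m a :
  exec dup_value (Store i (polish x ++ m) a [::])
    (Store i (polish x ++ polish x ++ m) a [::]) (33 * weight x).
Proof.
have w0 := weight_gt0 x.
apply: exec_weaken.
- apply: exec_seq; first exact: exec_to_aux.
  apply: exec_seq; first by apply: exec_from_aux_copying; rewrite all_rev polish_unmarked.
  apply: exec_seq; first exact: exec_tmp_to_aux.
  by rewrite revK cats0; apply: exec_return.
- by [].
- by rewrite revK cats0 size_rev -/(weight x); lia.
Qed.

(** The rest of [Main] and [Aux] is arbitrary, so a program can run while other values wait there;
    [Tmp] is scratch space, empty between programs. *)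
Definition computes (p : program) (x y : sexp) (t : nat) : Prop :=
  forall i m a,
    exec p (Store i (polish x ++ m) a [::]) (Store i (polish y ++ m) a [::]) t.

(** Monotonicity allows a size to be replaced by a bound on it, as composition requires. *)
Definition polynomially_bounded (T : nat -> nat) : Prop :=
  {homo T : m n / m <= n} /\ exists c k, forall n, T n <= c * n.+1 ^ k.

Lemma poly_const c : polynomially_bounded (fun=> c).
Proof. by split=> //; exists c, 0 => n; rewrite muln1. Qed.

Lemma poly_id : polynomially_bounded id.
Proof. by split=> //; exists 1, 1 => n; rewrite mul1n expn1. Qed.

Lemma poly_mul T U : polynomially_bounded T -> polynomially_bounded U ->
  polynomially_bounded (fun n => T n * U n).
Proof.
move=> [mT [c [k HT]]] [mU [d [l HU]]].
split=> [m n le_mn|]; first by rewrite leq_mul ?mT ?mU.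
by exists (c * d), (k + l) => n; rewrite expnD mulnACA leq_mul.
Qed.

Lemma poly_add T U : polynomially_bounded T -> polynomially_bounded U ->
  polynomially_bounded (fun n => T n + U n).
Proof.
move=> [mT [c [k HT]]] [mU [d [l HU]]].
split=> [m n le_mn|]; first by rewrite leq_add ?mT ?mU.
exists (c + d), (k + l) => n; rewrite mulnDl leq_add //.
  by apply: leq_trans (HT n) _; rewrite leq_mul2l leq_pexp2l ?leq_addr ?orbT.
by apply: leq_trans (HU n) _; rewrite leq_mul2l leq_pexp2l ?leq_addl ?orbT.
Qed.

Lemma poly_comp T U : polynomially_bounded T -> polynomially_bounded U ->
  polynomially_bounded (fun n => T (U n)).
Proof.
move=> [mT [c [k HT]]] [mU [d [l HU]]]; split=> [m n /mU /mT //|].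
exists (c * d.+1 ^ k), (l * k) => n; apply: leq_trans (HT _) _.
rewrite -mulnA leq_mul2l expnM -expnMn; apply/orP; right.
case: k {HT} => // k; rewrite leq_exp2r //.
have : 0 < n.+1 ^ l by rewrite expn_gt0.
by move: (HU n); nia.
Qed.

(** * Polynomial-time functions *)

Class codable (T : Type) := code : T -> sexp.
#[global] Hint Mode codable ! : typeclass_instances.

Definition spine (o : option bool) (s : seq sexp) : sexp := foldr Pair (Atom o) s.

#[global] Instance codable_sexp : codable sexp := id.
#[global] Instance codable_atom : codable (option bool) := Atom.
#[global] Instance codable_unit : codable unit := fun=> Atom None.
#[global] Instance codable_bool : codable bool := fun b => Atom (Some b).
#[global] Instance codable_prod A B `{codable A} `{codable B} : codable (A * B) :=
  fun x => Pair (code x.1) (code x.2).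
#[global] Instance codable_seq A `{codable A} : codable (seq A) :=
  fun s => spine None [seq code x | x <- s].
(** Unary notation is affordable because the numbers only count list entries; it also gives numbers
    the codes of lists over [unit], so they can be folded over. *)
#[global] Instance codable_nat : codable nat := fun n => spine None (nseq n (Atom None)).

Lemma code_pair A B `{codable A} `{codable B} (a : A) (b : B) :
  code (a, b) = Pair (code a) (code b).
Proof. by []. Qed.

Lemma weight_pair A B `{codable A} `{codable B} (a : A) (b : B) :
  weight (code (a, b)) = (weight (code a) + weight (code b)).+1.
Proof. exact: weight_Pair. Qed.

Section Polytime.
Context {A B : Type} {codA : codable A} {codB : codable B}.

(** The same [T] bounds time and output size; the latter is the input size of the next function in a
    composition. *)
Variant polytime (f : A -> B) : Prop :=
| Polytime p T of polynomially_bounded T &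
    forall a, computes p (code a) (code (f a)) (T (weight (code a))) /\
      weight (code (f a)) <= T (weight (code a)).

Lemma polytime_intro (f : A -> B) p T U :
  polynomially_bounded T -> polynomially_bounded U ->
  (forall a, computes p (code a) (code (f a)) (T (weight (code a)))) ->
  (forall a, weight (code (f a)) <= U (weight (code a))) ->
  polytime f.
Proof.
move=> pT pU HT HU; apply: (@Polytime _ p (fun n => T n + U n)); first exact: poly_add.
move=> a; split=> [i m x|]; last by rewrite (leq_trans (HU a)) ?leq_addl.
by apply: exec_le (HT a i m x) _; rewrite leq_addr.
Qed.

Lemma eq_polytime (f g : A -> B) : f =1 g -> polytime f -> polytime g.
Proof.
by move=> e [p T pT H]; apply: (@Polytime _ p T) => // a; rewrite -e.
Qed.

(** Such a function changes the type of its argument but not the stack. The program is a loop that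
    is never entered. *)
Lemma polytime_recode (f : A -> B) : (forall a, code (f a) = code a) -> polytime f.
Proof.
move=> e; apply: (@polytime_intro _ (While Main (fun=> false) (Pop Main)) (fun=> 1) (fun n => n)).
- exact: poly_const.
- exact: poly_id.
- by move=> a i m x; rewrite e; apply: exec_while_stop.
- by move=> a; rewrite e.
Qed.
End Polytime.

Section Basic.
Context {A B C D : Type} {codA : codable A} {codB : codable B}
  {codC : codable C} {codD : codable D}.

Lemma polytime_id : polytime (fun a : A => a).
Proof. exact: polytime_recode. Qed.

Lemma polytime_comp (f : B -> C) (g : A -> B) :
  polytime f -> polytime g -> polytime (fun a => f (g a)).
Proof.
move=> [p T pT Hf] [q U pU Hg].
apply: (@polytime_intro _ _ _ _ _ (Seq q p) (fun n => U n + T (U n)) (fun n => T (U n))).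
- by apply: poly_add => //; apply: poly_comp.
- exact: poly_comp.
- move=> a i m x; have [Hg1 Hg2] := Hg a; have [Hf1 Hf2] := Hf (g a).
  apply: exec_weaken.
  + by apply: exec_seq; [apply: Hg1 | apply: Hf1].
  + by [].
  + by rewrite leq_add2l; case: pT => mT _; apply: mT.
- move=> a; have [Hg1 Hg2] := Hg a; have [Hf1 Hf2] := Hf (g a).
  by apply: leq_trans Hf2 _; case: pT => mT _; apply: mT.
Qed.

(** The value of [f] waits on [Aux] while [g] consumes the second copy of the argument; with both
    values on [Main], one more symbol makes them a pair. *)
Lemma polytime_pair (f : A -> B) (g : A -> C) :
  polytime f -> polytime g -> polytime (fun a => (f a, g a)).
Proof.
move=> [p T pT Hf] [q U pU Hg].
apply: (@polytime_intro _ _ _ _ _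
  (Seq dup_value (Seq p (Seq to_aux (Seq q (Seq from_aux (Push Main Main (fun=> pair_symb)))))))
  (fun n => 33 * n + T n + 12 * T n + U n + 6 * T n + 2) (fun n => T n + U n + 1)).
- by repeat first [ assumption | apply: poly_add | apply: poly_mul | apply: poly_const | apply: poly_id].
- by repeat first [ assumption | apply: poly_add | apply: poly_const].
- move=> a i m x; have [Hf1 Hf2] := Hf a; have [Hg1 Hg2] := Hg a.
  apply: exec_weaken.
  + apply: exec_seq; first exact: exec_dup_value.
    apply: exec_seq; first exact: Hf1.
    apply: exec_seq; first exact: exec_to_aux.
    apply: exec_seq; first exact: Hg1.
    apply: exec_seq; first exact: exec_return.
    exact: exec_push.
  + by rewrite /= catA.
  + by lia.
- move=> a; have [Hf1 Hf2] := Hf a; have [Hg1 Hg2] := Hg a.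
  by rewrite weight_Pair /=; lia.
Qed.

Lemma polytime_fst : polytime (fun x : A * B => x.1).
Proof.
apply: (@polytime_intro _ _ _ _ _
  (Seq (Pop Main) (Seq to_aux (Seq drop_value from_aux))) (fun n => 34 * n) (fun n => n)).
- by apply: poly_mul; [apply: poly_const | apply: poly_id].
- exact: poly_id.
- move=> [a b] i m x; apply: exec_weaken.
  + apply: exec_seq; first exact: exec_pop.
    rewrite /= -catA.
    apply: exec_seq; first exact: exec_to_aux.
    apply: exec_seq; first exact: exec_drop_value.
    exact: exec_return.
  + by [].
  + by rewrite weight_Pair /=; lia.
- by move=> [a b]; rewrite weight_Pair /=; lia.
Qed.

Lemma polytime_snd : polytime (fun x : A * B => x.2).
Proof.
apply: (@polytime_intro _ _ _ _ _ (Seq (Pop Main) drop_value) (fun n => 16 * n) (fun n => n)).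
- by apply: poly_mul; [apply: poly_const | apply: poly_id].
- exact: poly_id.
- move=> [a b] i m x; apply: exec_weaken.
  + apply: exec_seq; first exact: exec_pop.
    by rewrite /= -catA; apply: exec_drop_value.
  + by [].
  + by rewrite weight_Pair /=; lia.
- by move=> [a b]; rewrite weight_Pair /=; lia.
Qed.

Lemma polytime_const (b : B) : polytime (fun _ : A => b).
Proof.
have [p Hp] : exists p, forall i m a,
    exec p (Store i m a [::]) (Store i (polish (code b) ++ m) a [::])
      (2 * weight (code b) + 1).
  rewrite /weight; elim: (polish _) => [|y w [p Hp]].
    by exists (While Main (fun=> false) (Pop Main)) => i m a; apply: exec_while_stop.
  exists (Seq p (Push Main Main (fun=> y))) => i m a; apply: exec_weaken.
  - by apply: exec_seq; [apply: Hp | apply: exec_push].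
  - by [].
  - by rewrite /=; set n := size w; lia.
apply: (@polytime_intro _ _ _ _ _ (Seq drop_value p)
  (fun n => 16 * n + (2 * weight (code b) + 1)) (fun=> weight (code b))).
- by repeat first [ apply: poly_add | apply: poly_mul | apply: poly_const | apply: poly_id].
- exact: poly_const.
- by move=> a i m x; apply: exec_seq; [apply: exec_drop_value | apply: Hp].
- by [].
Qed.
End Basic.

Definition sexp_true (x : sexp) : bool := if x is Atom (Some true) then true else false.

Lemma polytime_sexp_true : polytime sexp_true.
Proof.
apply: (@polytime_intro _ _ _ _ _
  (If Main (pred1 (Some (atom_symb (Some true))))
     (Seq drop_value (Push Main Main (fun=> atom_symb (Some true))))
     (Seq drop_value (Push Main Main (fun=> atom_symb (Some false)))))
  (fun n => 16 * n + 3) (fun=> 1)).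
- by repeat first [ apply: poly_add | apply: poly_mul | apply: poly_const | apply: poly_id].
- exact: poly_const.
- move=> x i m a.
  apply: exec_weaken (erefl _) _; first apply: exec_if.
    rewrite (_ : pred1 _ _ = sexp_true x); last by case: x => [[[]|]|].
    by case: sexp_true; apply: exec_seq; by [apply: exec_drop_value | apply: exec_push].
  by rewrite /code /codable_sexp; lia.
- by [].
Qed.

Section Control.
Context {A B C : Type} {codA : codable A} {codB : codable B} {codC : codable C}.

Lemma polytime_if (b : A -> bool) (f g : A -> B) :
  polytime b -> polytime f -> polytime g ->
  polytime (fun a => if b a then f a else g a).
Proof.
move=> pb [p T pT Hf] [q U pU Hg].
apply: (@polytime_comp _ _ _ _ _ _
  (fun x : bool * A => if x.1 then f x.2 else g x.2) (fun a => (b a, a)));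
  last by apply: polytime_pair; [exact: pb | exact: polytime_id].
apply: (@polytime_intro _ _ _ _ _
  (Seq (Pop Main) (If Main (pred1 (Some (atom_symb (Some true))))
     (Seq (Pop Main) p) (Seq (Pop Main) q)))
  (fun n => T n + U n + 3) (fun n => T n + U n)).
- by repeat first [ assumption | apply: poly_add | apply: poly_const].
- exact: poly_add.
- move=> [c a] i m x; have [Hf1 _] := Hf a; have [Hg1 _] := Hg a.
  have le_w : weight (code a) <= weight (code (c, a)) by rewrite weight_Pair /=; lia.
  have leT := pT.1 _ _ le_w; have leU := pU.1 _ _ le_w.
  case: c {le_w} leT leU => leT leU; apply: exec_weaken.
  + apply: exec_seq; first exact: exec_pop.
    by apply: exec_if; apply: exec_seq; [apply: exec_pop | apply: Hf1].
  + by [].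
  + by lia.
  + apply: exec_seq; first exact: exec_pop.
    by apply: exec_if; apply: exec_seq; [apply: exec_pop | apply: Hg1].
  + by [].
  + by lia.
- move=> [c a]; have [_ Hf2] := Hf a; have [_ Hg2] := Hg a.
  have le_w : weight (code a) <= weight (code (c, a)) by rewrite weight_Pair /=; lia.
  have leT := pT.1 _ _ le_w; have leU := pU.1 _ _ le_w.
  by case: c {le_w} leT leU => /= leT leU; lia.
Qed.

(** The first symbol of the code decides the case. Each branch then runs on the unchanged code,
    viewed at the type [A1] or [A2]; only the outer pair symbol is removed for the test and put
    back. *)
Lemma polytime_case {A1 A2 : Type} {cod1 : codable A1} {cod2 : codable A2}
    (pair_of : A1 -> A) (atom_of : A2 -> A) (f : A * C -> B) :
  (forall a, (exists a1 x y, [/\ a = pair_of a1, code a = code a1 & code a = Pair x y]) \/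
             (exists a2 o, [/\ a = atom_of a2, code a = code a2 & code a = Atom o])) ->
  polytime (fun x : A1 * C => f (pair_of x.1, x.2)) ->
  polytime (fun x : A2 * C => f (atom_of x.1, x.2)) ->
  polytime f.
Proof.
move=> cases [p T pT Hf] [q U pU Hg].
apply: (@polytime_intro _ _ _ _ _
  (Seq (Pop Main) (If Main is_pair_symb
     (Seq (Push Main Main (fun=> pair_symb)) p)
     (Seq (Push Main Main (fun=> pair_symb)) q)))
  (fun n => T n + U n + 4) (fun n => T n + U n)).
- by repeat first [ assumption | apply: poly_add | apply: poly_const].
- exact: poly_add.
- move=> [a c] i m x.
  case: (cases a) => [[a1 [y [z [ea ca1 ca]]]]|[a2 [o [ea ca2 ca]]]].
  + have [H _] := Hf (a1, c).
    have e : code (a, c) = code (a1, c) by rewrite !code_pair ca1.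
    apply: (@exec_weaken _ _ _ _ (1 + (2 + T (weight (code (a, c)))).+1)).
    * apply: exec_seq; first exact: exec_pop.
      apply: exec_if; rewrite /top /= ca /=.
      apply: exec_seq; first exact: exec_push.
      by move: (H i m x); rewrite -e -ea code_pair ca; apply.
    * by [].
    * by lia.
  + have [H _] := Hg (a2, c).
    have e : code (a, c) = code (a2, c) by rewrite !code_pair ca2.
    apply: (@exec_weaken _ _ _ _ (1 + (2 + U (weight (code (a, c)))).+1)).
    * apply: exec_seq; first exact: exec_pop.
      apply: exec_if; rewrite /top /= ca /=.
      apply: exec_seq; first exact: exec_push.
      by move: (H i m x); rewrite -e -ea code_pair ca; apply.
    * by [].
    * by lia.
- move=> [a c].
  case: (cases a) => [[a1 [y [z [ea ca1 ca]]]]|[a2 [o [ea ca2 ca]]]].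
  + have [_ H] := Hf (a1, c).
    have e : code (a, c) = code (a1, c) by rewrite !code_pair ca1.
    by rewrite e ea (leq_trans H) ?leq_addr.
  + have [_ H] := Hg (a2, c).
    have e : code (a, c) = code (a2, c) by rewrite !code_pair ca2.
    by rewrite e ea (leq_trans H) ?leq_addl.
Qed.
End Control.

(** * Folds over the spine of an S-expression *)

Section Fold.
Context {A S C L : Type} {codA : codable A} {codS : codable S}
  {codC : codable C} {codL : codable L}.
(** [L] stands for lists, unary numbers and arbitrary S-expressions; the spine of the last may end
    in any atom. *)
Variables (items : L -> seq A) (end_atom : L -> option bool).
Hypothesis codeL : forall l,
  code l = spine (end_atom l) [seq code x | x <- items l].
Variables (g : C * (A * S) -> S) (K : nat -> nat).
Hypothesis polyK : polynomially_bounded K.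
(* An iteration may not multiply the size of the accumulator. *)
Hypothesis growth : forall c a s,
  weight (code (g (c, (a, s)))) <=
  weight (code s) + K (weight (code c) + weight (code a)).

Local Notation fold c := (foldl (fun s a => g (c, (a, s)))).

Lemma weight_fold c s l w kc :
  (K (weight (code c) + w) <= kc) ->
  weight (spine None [seq code x | x <- l]) <= w ->
  weight (code (fold c s l)) <= weight (code s) + size l * kc.
Proof.
move=> le_k; elim: l s => [|a l IH] s /=; first by rewrite addn0.
rewrite weight_Pair => le_w; apply: leq_trans (IH _ _) _; first by lia.
have := growth c a s.
have : K (weight (code c) + weight (code a)) <= K (weight (code c) + w).
  by apply: polyK.1; rewrite leq_add2l; lia.
lia.
Qed.

Lemma weight_spine o l : weight (spine o l) = weight (spine None l).
Proof. by elim: l => //= x l IH; rewrite !weight_Pair IH. Qed.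

Lemma size_spine o l : size l < weight (spine o l).
Proof. by elim: l => //= x l IH; rewrite weight_Pair; lia. Qed.

(** Loop invariant: the rest of the list lies directly above the code of [(s, c)]. The outer pair
    symbol is added only for the body [h] and then popped, so that the test sees whether an item is
    left. [bs] bounds all later accumulators; the 4 steps per round are the test, the push and the
    pop. *)
Lemma exec_fold h T c o l s i m a w kc bs :
  polynomially_bounded T ->
  (forall x l s,
     computes h (Pair (Pair (code x) l) (code (s, c)))
       (Pair l (code (g (c, (x, s)), c)))
       (T (weight (Pair (Pair (code x) l) (code (s, c)))))) ->
  K (weight (code c) + w) <= kc ->
  weight (spine o [seq code x | x <- l]) <= w ->
  weight (code s) + size l * kc <= bs ->
  exec (While Main is_pair_symb
          (Seq (Push Main Main (fun=> pair_symb)) (Seq h (Pop Main))))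
    (Store i (polish (spine o [seq code x | x <- l]) ++
              pair_symb :: polish (code s) ++ polish (code c) ++ m) a [::])
    (Store i (atom_symb o :: pair_symb :: polish (code (fold c s l)) ++
              polish (code c) ++ m) a [::])
    (size l * (T (w + bs + weight (code c) + 3) + 4) + 1).
Proof.
move=> pT Hh le_k; elim: l s => [|x l IH] s; first by move=> _ _; apply: exec_while_stop.
rewrite [spine _ _]/= weight_Pair => le_w le_bs.
have step : weight (code (g (c, (x, s)))) <= weight (code s) + kc.
  apply: leq_trans (growth _ _ _) _; rewrite leq_add2l; apply: leq_trans le_k.
  by apply: polyK.1; lia.
apply: exec_weaken.
- apply: exec_while_go => //.
  + apply: exec_seq; first exact: exec_push.
    apply: exec_seq; last exact: exec_pop.
    move: (Hh x (spine o [seq @code A codA y | y <- l]) s i m a).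
    by rewrite /= -!catA /= -!catA; apply.
  + apply: (IH (g (c, (x, s)))); first by lia.
    by move: le_bs => /=; rewrite mulSn; lia.
- by [].
- set t := T (weight _).
  have: t <= T (w + bs + weight (code c) + 3).
    by apply: pT.1; rewrite code_pair !weight_Pair; lia.
  by rewrite /=; move: (size l) => n; nia.
Qed.

(** The loop ends with the final atom of the list and the fixed data still on the stack; they are
    part of the result here and are projected away afterwards. *)
Lemma polytime_fold_loop : polytime g ->
  polytime (fun x : L * (S * C) =>
    (Atom (end_atom x.1), (fold x.2.2 x.2.1 (items x.1), x.2.2))).
Proof.
move=> polyg.
have : polytime (fun x : (A * sexp) * (S * C) =>
    (x.1.2, (g (x.2.2, (x.1.1, x.2.1)), x.2.2))).
  have p1 : polytime (fun x : (A * sexp) * (S * C) => x.1.1).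
    by apply: (polytime_comp polytime_fst polytime_fst).
  have p2 : polytime (fun x : (A * sexp) * (S * C) => x.1.2).
    by apply: (polytime_comp polytime_snd polytime_fst).
  have p3 : polytime (fun x : (A * sexp) * (S * C) => x.2.1).
    by apply: (polytime_comp polytime_fst polytime_snd).
  have p4 : polytime (fun x : (A * sexp) * (S * C) => x.2.2).
    by apply: (polytime_comp polytime_snd polytime_snd).
  apply: polytime_pair => //; apply: polytime_pair => //.
  by apply: (polytime_comp polyg); apply: polytime_pair => //; apply: polytime_pair.
move=> [h T pT Hh].
(* For an input of weight [n]: the initial accumulator weighs at most [n], and each of at most [n]
   rounds adds at most [K (n + n)], because [c] and each item weigh at most [n]. *)
pose bs n := n + n * K (n + n).
have pbs : polynomially_bounded bs.
  apply: poly_add; first exact: poly_id.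
  apply: poly_mul; first exact: poly_id.
  by apply: (poly_comp polyK); apply: poly_add; apply: poly_id.
apply: (@polytime_intro _ _ _ _ _
  (Seq (Pop Main)
    (Seq (While Main is_pair_symb
            (Seq (Push Main Main (fun=> pair_symb)) (Seq h (Pop Main))))
         (Push Main Main (fun=> pair_symb))))
  (fun n => n * (T (n + bs n + n + 3) + 4) + 4)
  (fun n => bs n + n + 3)).
- have pT' : polynomially_bounded (fun n => T (n + bs n + n + 3)).
    apply: (poly_comp pT).
    by repeat first [ assumption | apply: poly_add | apply: poly_const | apply: poly_id].
  by repeat first [ assumption | apply: poly_add | apply: poly_mul | apply: poly_const | apply: poly_id].
- by repeat first [ assumption | apply: poly_add | apply: poly_const | apply: poly_id].
- move=> [l [s c]] i m a.
  set n := weight (code (l, (s, c))).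
  have le_n : weight (code l) + (weight (code s) + weight (code c)) <= n.
    by rewrite /n !code_pair !weight_Pair; lia.
  have sz : size (items l) <= n.
    have := size_spine (end_atom l) [seq @code A codA x | x <- items l].
    by rewrite -codeL size_map; lia.
  apply: exec_weaken.
  + apply: exec_seq; first exact: exec_pop.
    apply: exec_seq; last exact: exec_push.
    rewrite /= codeL -!catA /= -!catA.
    apply: (@exec_fold _ _ _ _ _ _ _ _ _ n (K (n + n)) (bs n) pT).
    * by move=> x l' s'; case: (Hh (x, l', (s', c))).
    * by apply: polyK.1; lia.
    * by rewrite -codeL; lia.
    * by rewrite /bs leq_add // ?leq_mul //; lia.
  + by rewrite /= -!catA.
  + have : T (n + bs n + weight (code c) + 3) <= T (n + bs n + n + 3).
      by apply: pT.1; lia.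
    move: (T _) (T _) sz => t u; move: (size _) => k; rewrite -/n.
    by move=> *; nia.
- move=> [l [s c]].
  set n := weight (code (l, (s, c))).
  have le_n : weight (code l) + (weight (code s) + weight (code c)) <= n.
    by rewrite /n !code_pair !weight_Pair; lia.
  have sz : size (items l) <= n.
    have := size_spine (end_atom l) [seq @code A codA x | x <- items l].
    by rewrite -codeL size_map; lia.
  have := @weight_fold c s (items l) n (K (n + n)).
  rewrite -(weight_spine (end_atom l)) -codeL => H.
  have {}H : weight (code (fold c s (items l))) <= weight (code s) + size (items l) * K (n + n).
    by apply: H; [apply: polyK.1; lia | lia].
  have : size (items l) * K (n + n) <= n * K (n + n) by rewrite leq_mul2r sz orbT.
  rewrite !code_pair !weight_Pair /bs.
  have -> : weight (code (Atom (end_atom (l, (s, c)).1))) = 1 by [].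
  by rewrite /=; lia.
Qed.

Lemma polytime_foldl (l : C -> L) (s0 : C -> S) : polytime g ->
  polytime l -> polytime s0 ->
  polytime (fun c => foldl (fun s a => g (c, (a, s))) (s0 c) (items (l c))).
Proof.
move=> pg pl ps.
apply: (@polytime_comp _ _ _ _ _ _ (fun x : sexp * (S * C) => x.2.1)
  (fun c => (Atom (end_atom (l c)), (fold c (s0 c) (items (l c)), c)))).
  exact: (polytime_comp polytime_fst polytime_snd).
apply: (@polytime_comp _ _ _ _ _ _ _ (fun c => (l c, (s0 c, c))) (polytime_fold_loop pg)).
apply: polytime_pair => //; apply: polytime_pair => //; exact: polytime_id.
Qed.
End Fold.

(** * Lists *)

Section Projections.
Context {A B C : Type} {codA : codable A} {codB : codable B} {codC : codable C}.

Lemma polytime_fst_of (f : C -> A * B) : polytime f -> polytime (fun c => (f c).1).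
Proof. exact: (polytime_comp polytime_fst). Qed.

Lemma polytime_snd_of (f : C -> A * B) : polytime f -> polytime (fun c => (f c).2).
Proof. exact: (polytime_comp polytime_snd). Qed.

End Projections.

Section Matching.
Context {A B C : Type} {codA : codable A} {codB : codable B} {codC : codable C}.

(** A nonempty list has the same code as the pair of its head and tail, so matching restructures
    nothing. *)
Lemma polytime_match_seq (l : C -> seq A) (f : C -> B) (g : (A * seq A) * C -> B) :
  polytime l -> polytime f -> polytime g ->
  polytime (fun c => match l c with [::] => f c | a :: s => g ((a, s), c) end).
Proof.
move=> pl pf pg.
pose h (x : seq A * C) := match x.1 with [::] => f x.2 | a :: s => g ((a, s), x.2) end.
apply: (@polytime_comp _ _ _ _ _ _ h (fun c => (l c, c)));
  last by apply: polytime_pair; [|exact: polytime_id].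
apply: (@polytime_case _ _ _ _ _ _ (A * seq A) unit _ _
  (fun x => x.1 :: x.2) (fun=> [::])).
- case=> [|a s]; [right | left].
    by exists tt, None.
  by exists (a, s), (code a), (code s).
- by apply: eq_polytime pg => -[[a s] c].
- apply: (@polytime_comp _ _ _ _ _ _ f snd) => //; exact: polytime_snd.
Qed.

Lemma polytime_match_nat (n : C -> nat) (f : C -> B) (g : nat * C -> B) :
  polytime n -> polytime f -> polytime g ->
  polytime (fun c => match n c with 0 => f c | m.+1 => g (m, c) end).
Proof.
move=> pn pf pg.
pose h (x : nat * C) := match x.1 with 0 => f x.2 | m.+1 => g (m, x.2) end.
apply: (@polytime_comp _ _ _ _ _ _ h (fun c => (n c, c)));
  last by apply: polytime_pair; [|exact: polytime_id].
apply: (@polytime_case _ _ _ _ _ _ (unit * nat) unit _ _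
  (fun x => x.2.+1) (fun=> 0)).
- case=> [|m]; [right | left].
    by exists tt, None.
  by exists (tt, m), (code tt), (code m).
- apply: (@polytime_comp _ _ _ _ _ _ g (fun x : unit * nat * C => (x.1.2, x.2))) => //.
  apply: polytime_pair; last exact: polytime_snd.
  by apply: polytime_snd_of; apply: polytime_fst.
- apply: (@polytime_comp _ _ _ _ _ _ f snd) => //; exact: polytime_snd.
Qed.

End Matching.

Section Constructors.
Context {A B C : Type} {codA : codable A} {codB : codable B} {codC : codable C}.

Lemma polytime_cons (f : C -> A) (g : C -> seq A) :
  polytime f -> polytime g -> polytime (fun c => f c :: g c).
Proof.
move=> pf pg; apply: (@polytime_comp _ _ _ _ _ _ (fun x => x.1 :: x.2) (fun c => (f c, g c))).
  by apply: polytime_recode => -[].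
exact: polytime_pair.
Qed.

Lemma polytime_succ (n : C -> nat) : polytime n -> polytime (fun c => (n c).+1).
Proof.
move=> pn; apply: (@polytime_comp _ _ _ _ _ _ (fun x : unit * nat => x.2.+1) (fun c => (tt, n c))).
  by apply: polytime_recode => -[[] m].
by apply: polytime_pair => //; apply: polytime_const.
Qed.

Lemma polytime_pred (n : C -> nat) : polytime n -> polytime (fun c => (n c).-1).
Proof.
move=> pn; apply: eq_polytime (polytime_match_nat pn (polytime_const 0) polytime_fst).
by move=> c /=; case: (n c).
Qed.

Lemma polytime_negb (b : C -> bool) : polytime b -> polytime (fun c => ~~ b c).
Proof.
move=> pb; apply: eq_polytime (polytime_if pb (polytime_const false) (polytime_const true)).
by move=> c /=; case: (b c).
Qed.

Lemma polytime_andb (b b' : C -> bool) :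
  polytime b -> polytime b' -> polytime (fun c => b c && b' c).
Proof. by move=> pb pb'; exact: (polytime_if pb pb' (polytime_const false)). Qed.

Lemma polytime_orb (b b' : C -> bool) :
  polytime b -> polytime b' -> polytime (fun c => b c || b' c).
Proof. by move=> pb pb'; exact: (polytime_if pb (polytime_const true) pb'). Qed.

Lemma polytime_eq_bool (b b' : C -> bool) :
  polytime b -> polytime b' -> polytime (fun c => b c == b' c).
Proof.
move=> pb pb'; apply: eq_polytime (polytime_if pb pb' (polytime_negb pb')).
by move=> c /=; case: (b c); case: (b' c).
Qed.

Lemma polytime_nilp (l : C -> seq A) : polytime l -> polytime (fun c => nilp (l c)).
Proof.
move=> pl; apply: eq_polytime (polytime_match_seq pl (polytime_const true) (polytime_const false)).
by move=> c /=; case: (l c).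
Qed.

Lemma polytime_behead (l : C -> seq A) : polytime l -> polytime (fun c => behead (l c)).
Proof.
move=> pl; apply: eq_polytime (polytime_match_seq pl (polytime_const [::])
  (polytime_snd_of polytime_fst)).
by move=> c /=; case: (l c).
Qed.
End Constructors.

Ltac polytime_known :=
  first
    [ assumption
    | match goal with
      | H : polytime ?f |- polytime (fun x => ?f (@?h x)) =>
          apply: (polytime_comp H (g := h))
      end ].

Ltac polytime_step :=
  first
    [ polytime_known | apply: polytime_id | apply: polytime_const
    | apply: polytime_fst_of | apply: polytime_snd_of | apply: polytime_pair
    | apply: polytime_cons | apply: polytime_succ | apply: polytime_pred
    | apply: polytime_andb | apply: polytime_orb | apply: polytime_negb
    | apply: polytime_eq_bool | apply: polytime_nilp | apply: polytime_behead
    | apply: polytime_if ].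

Ltac polytime_basic := repeat polytime_step.

Lemma weight_succ n : weight (code n.+1) = (weight (code n)).+2.
Proof. exact: weight_Pair. Qed.

Section Lists.
Context {A B C : Type} {codA : codable A} {codB : codable B} {codC : codable C}.

Lemma polytime_fold_seq {S : Type} {codS : codable S}
    (g : C * (A * S) -> S) (K : nat -> nat) (l : C -> seq A) (s0 : C -> S) :
  polynomially_bounded K ->
  (forall c a s, weight (code (g (c, (a, s)))) <=
     weight (code s) + K (weight (code c) + weight (code a))) ->
  polytime g -> polytime l -> polytime s0 ->
  polytime (fun c => foldl (fun s a => g (c, (a, s))) (s0 c) (l c)).
Proof.
move=> pK growth pg pl ps.
exact: (@polytime_foldl _ _ _ _ _ _ _ _ id (fun=> None) _ _ _ pK growth).
Qed.

(** The body under a binder is a function of the context paired with the bound element; this is why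
    the closure lemmas are stated for an arbitrary context [C]. *)
Lemma polytime_all (p : C * A -> bool) (l : C -> seq A) :
  polytime p -> polytime l -> polytime (fun c => all (fun a => p (c, a)) (l c)).
Proof.
move=> pp pl; pose g (x : C * (A * bool)) := x.2.2 && p (x.1, x.2.1).
apply: (@eq_polytime _ _ _ _ (fun c => foldl (fun s a => g (c, (a, s))) true (l c))).
  move=> c; rewrite (_ : all _ _ = true && all (fun a => p (c, a)) (l c)) //.
  by elim: (l c) true => [|a s IH] b /=; rewrite ?andbT // IH /g /= andbA.
apply: (polytime_fold_seq (poly_const 0)) => //; last exact: polytime_const.
rewrite /g; polytime_basic.
Qed.

Lemma polytime_count (p : C * A -> bool) (l : C -> seq A) :
  polytime p -> polytime l -> polytime (fun c => count (fun a => p (c, a)) (l c)).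
Proof.
move=> pp pl; pose g (x : C * (A * nat)) := if p (x.1, x.2.1) then x.2.2.+1 else x.2.2.
apply: (@eq_polytime _ _ _ _ (fun c => foldl (fun s a => g (c, (a, s))) 0 (l c))).
  move=> c; rewrite -[RHS]add0n.
  elim: (l c) 0 => [|a s IH] n /=; rewrite ?addn0 // IH /g /=.
  by case: ifP => _; rewrite ?addSnnS.
apply: (polytime_fold_seq (poly_const 2)) => //; last exact: polytime_const.
  move=> c a n; rewrite /g /=; case: ifP => _; last exact: leq_addr.
  by rewrite weight_succ; lia.
by rewrite /g; polytime_basic.
Qed.

Lemma weight_cons (a : A) s : weight (code (a :: s)) = (weight (code a) + weight (code s)).+1.
Proof. exact: weight_Pair. Qed.

Lemma polytime_rev (l : C -> seq A) : polytime l -> polytime (fun c => rev (l c)).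
Proof.
move=> pl; pose g (x : C * (A * seq A)) := x.2.1 :: x.2.2.
apply: (@eq_polytime _ _ _ _ (fun c => foldl (fun s a => g (c, (a, s))) [::] (l c))).
  move=> c; rewrite /rev; elim: (l c) [::] => //=.
apply: (@polytime_fold_seq _ _ _ succn) => //.
- by apply: (poly_add (poly_const 1) poly_id).
- by move=> c a s; rewrite /g /= weight_cons; lia.
- by rewrite /g; polytime_basic.
- exact: polytime_const.
Qed.

(** A left fold that prepends reverses its list, which is therefore reversed beforehand, as for
    filters and maps below. *)
Lemma polytime_cat (l l' : C -> seq A) :
  polytime l -> polytime l' -> polytime (fun c => l c ++ l' c).
Proof.
move=> pl pl'; pose g (x : C * (A * seq A)) := x.2.1 :: x.2.2.
apply: (@eq_polytime _ _ _ _ (fun c => foldl (fun s a => g (c, (a, s))) (l' c) (rev (l c)))).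
  move=> c; rewrite foldl_rev; elim: (l c) => //= a s ->; exact: erefl.
apply: (@polytime_fold_seq _ _ _ succn) => //.
- by apply: (poly_add (poly_const 1) poly_id).
- by move=> c a s; rewrite /g /= weight_cons; lia.
- by rewrite /g; polytime_basic.
- exact: polytime_rev.
Qed.

Lemma polytime_filter (p : C * A -> bool) (l : C -> seq A) :
  polytime p -> polytime l -> polytime (fun c => [seq a <- l c | p (c, a)]).
Proof.
move=> pp pl.
pose g (x : C * (A * seq A)) := if p (x.1, x.2.1) then x.2.1 :: x.2.2 else x.2.2.
apply: (@eq_polytime _ _ _ _ (fun c => foldl (fun s a => g (c, (a, s))) [::] (rev (l c)))).
  move=> c; rewrite foldl_rev; elim: (l c) => //= a s ->; exact: erefl.
apply: (@polytime_fold_seq _ _ _ succn) => //.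
- by apply: (poly_add (poly_const 1) poly_id).
- by move=> c a s; rewrite /g /=; case: ifP => _; rewrite ?weight_cons; lia.
- by rewrite /g; polytime_basic.
- exact: polytime_rev.
- exact: polytime_const.
Qed.

Lemma polytime_map (f : C * A -> B) (l : C -> seq A) :
  polytime f -> polytime l -> polytime (fun c => [seq f (c, a) | a <- l c]).
Proof.
move=> pf pl; pose g (x : C * (A * seq B)) := f (x.1, x.2.1) :: x.2.2.
apply: (@eq_polytime _ _ _ _ (fun c => foldl (fun s a => g (c, (a, s))) [::] (rev (l c)))).
  move=> c; rewrite foldl_rev; elim: (l c) => //= a s ->; exact: erefl.
have pg : polytime g by rewrite /g; polytime_basic.
have [q T pT Hf] := pf.
(* The weight of an image depends on the context and the element only, never on the accumulator, so
   it counts as additive growth. *)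
apply: (@polytime_fold_seq _ _ _ (fun n => (T n.+1).+1)) => //.
- apply: (poly_add (poly_const 1)); apply: (poly_comp pT).
  exact: (poly_add (poly_const 1) poly_id).
- move=> c a s; have [_] := Hf (c, a); rewrite code_pair weight_Pair /g /=.
  have -> : weight (code (f (c, a) :: s)) = (weight (code (f (c, a))) + weight (code s)).+1.
    exact: weight_Pair.
  by lia.
- exact: polytime_rev.
- exact: polytime_const.
Qed.
End Lists.

Section MoreLists.
Context {A B C : Type} {codA : codable A} {codB : codable B} {codC : codable C}.

Lemma polytime_head (x : A) (l : C -> seq A) :
  polytime l -> polytime (fun c => head x (l c)).
Proof.
move=> pl.
apply: eq_polytime (polytime_match_seq pl (polytime_const x) (polytime_fst_of polytime_fst)).
by move=> c /=; case: (l c).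
Qed.

Lemma weight_cat (s t : seq A) :
  weight (code (s ++ t)) < weight (code s) + weight (code t).
Proof. by elim: s => //= a s IH; rewrite !weight_cons; lia. Qed.

Lemma polytime_flatten (ll : C -> seq (seq A)) :
  polytime ll -> polytime (fun c => flatten (ll c)).
Proof.
move=> pll; pose g (x : C * (seq A * seq A)) := x.2.1 ++ x.2.2.
apply: (@eq_polytime _ _ _ _ (fun c => foldl (fun s a => g (c, (a, s))) [::] (rev (ll c)))).
  by move=> c; rewrite foldl_rev.
apply: (polytime_fold_seq poly_id) => //.
- by move=> c a s; have := weight_cat a s; rewrite /g /=; lia.
- by rewrite /g; apply: polytime_cat; polytime_basic.
- exact: polytime_rev.
- exact: polytime_const.
Qed.

(** The unread part of the second list belongs to the accumulator; moving its head into the result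
    therefore costs no growth beyond the entry of the first list. *)
Lemma polytime_zip (l : C -> seq A) (l' : C -> seq B) :
  polytime l -> polytime l' -> polytime (fun c => zip (l c) (l' c)).
Proof.
move=> pl pl'.
pose g (x : C * (A * (seq B * seq (A * B)))) :=
  match x.2.2.1 with
  | [::] => x.2.2
  | b :: s => (s, (x.2.1, b) :: x.2.2.2)
  end.
apply: (@eq_polytime _ _ _ _
    (fun c => rev (foldl (fun s a => g (c, (a, s))) (l' c, [::]) (l c)).2)).
  move=> c; suff H z : rev (foldl (fun s a => g (c, (a, s))) (l' c, z) (l c)).2 =
      rev z ++ zip (l c) (l' c) by apply: H.
  elim: (l c) (l' c) z => [|a s IH] [|b t] z /=; rewrite ?cats0 //.
    by rewrite IH; case: (s) => [|? ?]; rewrite /= cats0.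
  by rewrite IH /= rev_cons cat_rcons.
apply: polytime_rev; apply: polytime_snd_of.
apply: (@polytime_fold_seq _ _ _ _ _ _ _ (fun n => n + 1)) => //.
- by apply: (poly_add poly_id (poly_const 1)).
- move=> c a [[|b s] z]; rewrite /g //= ?leq_addr //.
  by rewrite (weight_pair s) (weight_pair (b :: s)) (weight_cons b s) (weight_cons (a, b) z)
    (weight_pair a b); lia.
- rewrite /g.
  apply: (@polytime_match_seq _ _ _ _ _ _ (fun x : C * (A * (seq B * seq (A * B))) => x.2.2.1)
    (fun x => x.2.2) (fun y => (y.1.2, (y.2.2.1, y.1.1) :: y.2.2.2.2))); polytime_basic.
- by polytime_basic.
Qed.
End MoreLists.

Section Comparisons.
Context {C : Type} {codC : codable C}.

(** The truncated difference is computed by iterating the predecessor, with the unary number [n c]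
    as the list that drives the fold. *)
Lemma polytime_leq (m n : C -> nat) :
  polytime m -> polytime n -> polytime (fun c => m c <= n c).
Proof.
move=> pm pn; pose g (x : C * (unit * nat)) := x.2.2.-1.
have codeE k : code k = spine None [seq code x | x <- nseq k tt].
  by rewrite map_nseq.
have : polytime (fun c => foldl (fun s a => g (c, (a, s))) (m c) (nseq (n c) tt)).
  apply: (polytime_foldl codeE (poly_const 0)) => //.
    by move=> c a [|k]; rewrite /g /= ?weight_succ; lia.
  by rewrite /g; polytime_basic.
move=> /polytime_match_nat/(_ (polytime_const true))/(_ (polytime_const false)).
apply: eq_polytime => c; rewrite /leq.
have -> : foldl (fun s a => g (c, (a, s))) (m c) (nseq (n c) tt) = m c - n c.
  elim: (n c) (m c) => [|k IH] j /=; first by rewrite subn0.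
  by rewrite IH /g /=; lia.
by case: (m c - n c).
Qed.

Lemma polytime_eq_seq {A : eqType} {codA : codable A} (l l' : C -> seq A) :
  polytime (fun x : A * A => x.1 == x.2) -> polytime l -> polytime l' ->
  polytime (fun c => l c == l' c).
Proof.
move=> pe pl pl'.
pose g (x : C * (A * (bool * seq A))) :=
  match x.2.2.2 with
  | [::] => (false, [::])
  | b :: s => (x.2.2.1 && (x.2.1 == b), s)
  end.
apply: (@eq_polytime _ _ _ _ (fun c =>
    let r := foldl (fun s a => g (c, (a, s))) (true, l' c) (l c) in r.1 && nilp r.2)).
  move=> c; rewrite /= -[RHS]andTb.
  elim: (l c) (l' c) true => [|a s IH] [|b t] ok //=; rewrite IH ?andbF //=.
  by rewrite eqseq_cons andbA.
have pr : polytime (fun c => foldl (fun s a => g (c, (a, s))) (true, l' c) (l c)).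
  apply: (@polytime_fold_seq _ _ _ _ _ _ _ (fun=> 0)) => //.
  - exact: poly_const.
  - move=> c a [b [|a' s]]; rewrite /g /= !(weight_pair (_ : bool)) ?weight_cons ?addn0 //.
    have w1 b' : weight (code (b' : bool)) = 1 by [].
    by rewrite !w1; lia.
  - rewrite /g.
    apply: (@polytime_match_seq _ _ _ _ _ _ (fun x : C * (A * (bool * seq A)) => x.2.2.2)
      (fun x => (false, [::]))
      (fun y => (y.2.2.2.1 && (y.2.2.1 == y.1.1), y.1.2))); polytime_basic.
    apply: (polytime_comp pe (g := fun y => (y.2.2.1, y.1.1))); polytime_basic.
  - by polytime_basic.
by polytime_basic.
Qed.
End Comparisons.

Fixpoint items (x : sexp) : seq sexp := if x is Pair y z then y :: items z else [::].

(** Any S-expression is the spine of its items with some final atom, so the general fold applies to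
    it directly. *)
Lemma polytime_items {C : Type} {codC : codable C} (f : C -> sexp) :
  polytime f -> polytime (fun c => items (f c)).
Proof.
move=> pf.
pose fix end_atom (x : sexp) := match x with Pair _ z => end_atom z | Atom o => o end.
have codeE (x : sexp) : code x = spine (end_atom x) [seq code y | y <- items x].
  by rewrite /code /codable_sexp map_id; elim: x => //= y _ z {1}->.
pose g (x : C * (sexp * seq sexp)) := x.2.1 :: x.2.2.
apply: (@eq_polytime _ _ _ _ (fun c =>
    rev (foldl (fun s a => g (c, (a, s))) [::] (items (f c))))).
  move=> c; rewrite -[RHS]revK; congr rev; rewrite /rev.
  by elim: (items _) [::] => [|y s IH] t //=; apply: IH.
apply: polytime_rev; apply: (polytime_foldl codeE (poly_add poly_id (poly_const 1))) => //.
- by move=> c a s; rewrite /g /= weight_cons; lia.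
- by rewrite /g; polytime_basic.
- exact: polytime_const.
Qed.

(** * From the input tape to the stack *)

#[global] Instance codable_symbol : codable symbol :=
  fun x => code match x with inl b => (true, b) | inr b => (false, b) end.


Definition tag_symb (o : option symb) : symb :=
  atom_symb (if o is Some (inl (inl _)) then Some true else Some false).

Definition bit_symb (o : option symb) : symb :=
  match o with
  | Some (inl (inl b)) => atom_symb (Some b)
  | Some (inl (inr b)) => atom_symb (Some b)
  | _ => mark
  end.

(** Each symbol is prepended to the list, so the word arrives reversed. The four pushes build a list
    cell from its end: the bit, the tag, the pair that codes the symbol, and the pair that is the
    cell. *)
Definition load : program :=
  Seq (Push Main Main (fun=> atom_symb None))
    (While In isSome
      (Seq (Push Main In bit_symb) (Seq (Push Main In tag_symb)
        (Seq (Push Main Main (fun=> pair_symb))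
          (Seq (Push Main Main (fun=> pair_symb)) (Pop In)))))).

Lemma exec_load (w : seq symbol) :
  exec load (Store [seq inl x | x <- w] [::] [::] [::])
    (Store [::] (polish (code (rev w))) [::] [::]) (10 * size w + 3).
Proof.
have loop s : exec (While In isSome
      (Seq (Push Main In bit_symb) (Seq (Push Main In tag_symb)
        (Seq (Push Main Main (fun=> pair_symb))
          (Seq (Push Main Main (fun=> pair_symb)) (Pop In))))))
      (Store [seq inl x | x <- w] (polish (code s)) [::] [::])
      (Store [::] (polish (code (catrev w s))) [::] [::]) (10 * size w + 1).
  elim: w s => [|x w IH] s; first exact: exec_while_stop.
  apply: exec_weaken.
  + apply: exec_while_go; [by []| |exact: (IH (x :: s))].
    apply: exec_seq; first exact: exec_push.
    apply: exec_seq; first exact: exec_push.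
    apply: exec_seq; first exact: exec_push.
    apply: exec_seq; first exact: exec_push.
    by case: x => b; apply: exec_pop.
  + by [].
  + by rewrite /=; lia.
apply: exec_weaken.
- by apply: exec_seq; [apply: exec_push | apply: (loop [::])].
- by [].
- by lia.
Qed.

Lemma weight_symbols (w : seq symbol) : weight (code w) = 4 * size w + 1.
Proof.
elim: w => //= x w IH; rewrite weight_cons IH.
by have -> : weight (code x) = 3 by [case: (x)]; lia.
Qed.

Lemma polytime_PTIME (f : seq symbol -> bool) (L : seq symbol -> Prop) :
  polytime f -> (forall w, reflect (L w) (f (rev w))) -> PTIME L.
Proof.
move=> [p T pT Hf] Lf.
have [_ [c [k Hc]]] : polynomially_bounded (fun n => (10 * n + 3 + T (4 * n + 1)).+1).
  have p4 a b : polynomially_bounded (fun n => a * n + b).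
    by repeat first [ apply: poly_add | apply: poly_mul | apply: poly_const | apply: poly_id].
  apply: (poly_add (poly_const 1)); apply: poly_add => //; exact: poly_comp.
exists (@machine_of _ _ (Seq load p) (pred1 (Some (atom_symb (Some true))))), (c * 2 ^ k), k => w.
have [|t le_t vt] := @machine_verdict _ _ (Seq load p) (pred1 (Some (atom_symb (Some true)))) w
  (Store [::] (polish (code (f (rev w)))) [::] [::]) (10 * size w + 3 + T (4 * size w + 1)).
  apply: exec_seq; first exact: exec_load.
  have [H _] := Hf (rev w); move: (H [::] [::] [::]).
  by rewrite !cats0 weight_symbols size_rev.
exists t.
  apply: leq_trans le_t _; apply: leq_trans (Hc _) _.
  (* For nonempty words [(n + 1) ^ k] is at most [2 ^ k * n ^ k], which explains the constant
     [c * 2 ^ k]; the additive term takes care of the empty word. *)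
  case: (size w) => [|n]; first by have := expn_gt0 2 k; rewrite exp1n; nia.
  apply: leq_trans (leq_addr _ _); rewrite -mulnA leq_mul2l -expnMn; apply/orP; right.
  by case: k {Hc} => // k; rewrite leq_exp2r //; lia.
by rewrite vt; case: Lf => H; split.
Qed.

(** * Good contributions *)

(** The three preferences differ only in the resources on which the joint claims must be met: none,
    all, or those of the own goal, which are the ones that [restrict] keeps. *)
Definition counted (T : eqType) (pref : preference) (g : seq T) (r : T) : bool :=
  match pref with ct => false | pca => true | ppca => r \in g end.

Section Supplies.
Variables (T : eqType) (pref : preference) (n : nat) (g : 'I_n -> seq T).
Implicit Types (i j : 'I_n) (r : T) (X o e c : T -> nat) (S : {set 'I_n}).

Definition covers X j : bool := all (fun r => count_mem r (g j) <= X r) (g j).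

Definition claims i X r : nat :=
  counted pref (g i) r * \sum_(j | covers X j) count_mem r (g j).

(* With the total supply [X], the profile is good for [i]. *)
Definition good_supply i X : Prop :=
  covers X i /\ forall r, claims i X r <= X r.

(** The set [S] is a parameter, not computed from a supply; this separation is what makes the
    requirement monotone. *)
Definition needs i S r : nat :=
  maxn (count_mem r (g i)) (counted pref (g i) r * \sum_(j in S) count_mem r (g j)).

(** The maximum is the total supply when [i] adds to [o] only what the needs for [S] still lack. *)
Definition satisfiable i o S : {set 'I_n} :=
  [set j | covers (fun r => maxn (o r) (needs i S r)) j].

Definition forced i o : {set 'I_n} := iter n (satisfiable i o) set0.

Lemma coversP X j : reflect (forall r, count_mem r (g j) <= X r) (covers X j).
Proof.
apply: (iffP allP) => [H r|H r _]; last exact: H.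
by have [/H//|/count_memPn ->] := boolP (r \in g j).
Qed.

Lemma covers_mono X Y j : (forall r, X r <= Y r) -> covers X j -> covers Y j.
Proof. by move=> XY /coversP H; apply/coversP => r; apply: leq_trans (XY r). Qed.

Lemma needs_mono i S S' r : S \subset S' -> needs i S r <= needs i S' r.
Proof.
move=> sSS'; rewrite geq_max leq_maxl /= leq_max leq_mul2l; apply/orP; right.
apply/orP; right; rewrite [X in _ <= X](big_setID S) /=.
by rewrite (setIidPr sSS') leq_addr.
Qed.

(** The operator is monotone on subsets of an n-element set: its iterates from the empty set
    increase, and each one before the fixed point gains a player. *)
Lemma forced_fixed i o : satisfiable i o (forced i o) = forced i o.
Proof.
have mono : {homo satisfiable i o : S S' / S \subset S'}.
  move=> S S' sSS'; apply/subsetP => j; rewrite !inE; apply: covers_mono => r.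
  by rewrite geq_max leq_maxl /= leq_max needs_mono ?orbT.
by have := fixsetK mono; rewrite /fixset card_ord.
Qed.

Lemma eq_covers X Y : X =1 Y -> covers X =1 covers Y.
Proof. by move=> e j; apply: eq_all => r; rewrite e. Qed.

Lemma good_supply_ext i X Y : X =1 Y -> good_supply i X -> good_supply i Y.
Proof.
move=> e [H1 H2]; split=> [|r]; first by rewrite -(eq_covers e).
rewrite -e; apply: leq_trans (H2 r); rewrite /claims.
by rewrite (eq_bigl _ _ (eq_covers e)).
Qed.

(* The claims in [needs i (forced i o)] cannot be avoided by a contribution of
   [i] that is good for [i], and meeting exactly these claims is good. *)
Lemma good_contribution i o e :
  (exists c, (forall r, c r <= e r) /\ good_supply i (fun r => o r + c r)) <->
  (forall r, needs i (forced i o) r <= o r + e r).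
Proof.
split=> [[c [le_c [cov cl]]] r|H].
  set X := fun r => o r + c r in cov cl.
  (* The claims under [X] sum over all players that [X] satisfies, hence include those of [S]. *)
  have needsX S : S \subset [set j | covers X j] -> forall r, needs i S r <= X r.
    move=> sS x; rewrite geq_max (coversP _ _ cov) /=; apply: leq_trans (cl x).
    rewrite leq_mul2l; apply/orP; right.
    rewrite [leqLHS]big_mkcond [leqRHS]big_mkcond leq_sum // => j _.
    by case: ifP => // /(subsetP sS); rewrite inE => ->.
  apply: leq_trans (needsX (forced i o) _ r) _; last by rewrite leq_add2l.
  (* Each stage adds only players already satisfied by [X], because [X] dominates both [o] and the
     needs of the previous stage. *)
  suff H k : iter k (satisfiable i o) set0 \subset [set j | covers X j] by exact: H.
  elim: k => [|k IH]; first exact: sub0set.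
  apply/subsetP => j; rewrite !inE; apply: covers_mono => x.
  by rewrite geq_max leq_addr needsX.
(* Truncated subtraction contributes nothing where the others suffice, so the total is the maximum
   of [o] and the needs. *)
exists (fun r => needs i (forced i o) r - o r).
split=> [r|]; first by rewrite leq_subLR.
apply: (@good_supply_ext _ (fun r => maxn (o r) (needs i (forced i o) r))).
  by move=> r; rewrite maxnE.
split=> [|r]; first by apply/coversP => r; rewrite !leq_max leqnn orbT.
rewrite leq_max; apply/orP; right; rewrite leq_max; apply/orP; right.
rewrite /claims leq_mul2l; apply/orP; right.
(* By the fixed point equation, the players satisfied by this supply are exactly the forced ones, so
   no claim is left uncounted. *)
rewrite [X in _ <= X](eq_bigl (covers (fun r => maxn (o r) (needs i (forced i o) r)))) //.
by move=> j; rewrite -[in LHS]forced_fixed inE.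
Qed.

End Supplies.

(** * Bags of atomic resources as supply functions *)

Section Bags.
Variable Res : choiceType.
Implicit Types (A B : {mset Res}) (X Y : bag Res) (r : Res).

Lemma bigmsetE (I : Type) (s : seq I) (Q : pred I) (F : I -> {mset Res}) r :
  (\big[msetD/mset0]_(i <- s | Q i) F i) r = \sum_(i <- s | Q i) F i r.
Proof. by apply: (big_morph (fun A : {mset Res} => A r)) => [A B|]; rewrite /= ?msetE2 ?mset0E. Qed.

Lemma flat_bagE X r : flat_bag X r = \sum_(B <- X) B r.
Proof. exact: bigmsetE. Qed.

Lemma flat_bag_of (s : seq (seq Res)) r : flat_bag (bag_of s) r = count_mem r (flatten s).
Proof.
rewrite flat_bagE (perm_big _ (perm_eq_seq_mset _)) /= big_map count_flatten sumnE big_map.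
by apply: eq_bigr => b _; rewrite mset_seqE.
Qed.

Lemma flat_bagD X Y r : flat_bag (X `+` Y) r = flat_bag X r + flat_bag Y r.
Proof.
rewrite !flat_bagE -big_cat; apply: perm_big.
by apply/allP => B _ /=; rewrite count_cat !count_mem_mset msetE2.
Qed.

Lemma flat_bag0 r : flat_bag (mset0 : bag Res) r = 0.
Proof. by rewrite flat_bagE enum_mset0 big_nil. Qed.

Lemma flat_bag_sum (I : Type) (s : seq I) (F : I -> bag Res) r :
  flat_bag (\big[msetD/mset0]_(i <- s) F i) r = \sum_(i <- s) flat_bag (F i) r.
Proof.
by apply: (big_morph (fun X : bag Res => flat_bag X r)) => [X Y|]; rewrite ?flat_bagD ?flat_bag0.
Qed.

Definition atomic X : Prop := forall B, B \in X -> exists r, B = [mset r].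

Lemma atomicS X Y : X `<=` Y -> atomic Y -> atomic X.
Proof. by move=> /msubset_subset sXY aY B /sXY /aY. Qed.

Lemma mset1_inj : injective (fun r : Res => [mset r]).
Proof.
move=> r r' /(congr1 (fun A : {mset Res} => A r)).
by rewrite !msetnE eqxx; case: eqP.
Qed.

Lemma flat_bag_atomic X r : atomic X -> flat_bag X r = X [mset r].
Proof.
move=> aX; rewrite flat_bagE -count_mem_mset -sum1_count [RHS]big_mkcond /=.
apply: eq_big_seq => B /aX[r' ->]; rewrite msetnE (inj_eq mset1_inj) eq_sym.
by case: eqP.
Qed.

(** An atomic bag is determined by its flattening, since [[mset r]] occurs in it as often as [r] is
    supplied. For general bundles the right-to-left direction fails. *)
Lemma atomic_msubset X Y : atomic X ->  atomic Y ->
  (X `<=` Y) <-> (forall r, flat_bag X r <= flat_bag Y r).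
Proof.
move=> aX aY; split=> [/msubsetP sXY r|H]; first by rewrite !flat_bag_atomic.
apply/msubsetP => B; have [/aX[r ->]|/mset_eq0P->//] := boolP (B \in X).
by rewrite -!flat_bag_atomic.
Qed.

(** The bound by a bag gives [c] finite support, so that it is a multiset. *)
Lemma flat_bag_inv (c : Res -> nat) X :
  (forall r, c r <= flat_bag X r) ->
  exists Y, atomic Y /\ forall r, flat_bag Y r = c r.
Proof.
move=> le_c; pose A : {mset Res} := [fsfun r in finsupp (flat_bag X) => c r].
have AE r : A r = c r.
  rewrite fsfunE; case: ifPn => // nr; apply/esym/eqP; rewrite -leqn0.
  by rewrite (leq_trans (le_c r)) // leqn0 fsfun_dflt.
exists (bag_of [seq [:: r] | r <- A]); split=> [B|r].
  rewrite /bag_of (perm_mem (perm_eq_seq_mset _)) -map_comp => /mapP[r _ ->].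
  by exists r; apply/msetP => x; rewrite /= mset_seqE msetnE /= addn0 eq_sym; case: eqP.
rewrite flat_bag_of -AE -(count_mem_mset r A).
by congr count; elim: (enum_mset _) => //= x s ->.
Qed.
End Bags.

Lemma restrict_seq (Res : choiceType) (s t : seq Res) r :
  restrict (seq_mset s) (seq_mset t) r = (r \in t) * count_mem r s.
Proof.
rewrite fsfunE msuppE in_mset !mset_seqE -has_count has_pred1.
by case: (r \in t); rewrite ?mul1n.
Qed.

(** * Equilibria in terms of supplies *)

Section Equilibrium.
Variables (Res : choiceType) (n : nat) (pref : preference).
Variables (gl : 'I_n -> seq Res) (el pl : 'I_n -> seq (seq Res)).

Definition listed_game : RCG Res n :=
  Game (fun i => seq_mset (gl i)) (fun i => bag_of (el i)).

Definition listed_profile (i : 'I_n) : bag Res := bag_of (pl i).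

Local Notation G := listed_game.
Local Notation P := listed_profile.
Implicit Types (Q : 'I_n -> bag Res) (i j : 'I_n) (C : bag Res).

Definition supply Q : Res -> nat := flat_bag (outcome Q).

Lemma potentially_satisfiedE Q j : potentially_satisfied G Q j = covers gl (supply Q) j.
Proof.
by apply/msubsetP/coversP => H r; have := H r; rewrite mset_seqE.
Qed.

Lemma goodP Q i : reflect (good_supply pref gl i (supply Q)) (good G pref Q i).
Proof.
have sumE r : \sum_(s | potentially_satisfied G Q s) count_mem r (gl s) =
    \sum_(s | covers gl (supply Q) s) count_mem r (gl s).
  by apply: eq_bigl => s; rewrite potentially_satisfiedE.
apply: (iffP idP); rewrite /good /good_supply /claims /counted.
  case: pref => [|/andP[]|/andP[]]; rewrite potentially_satisfiedE => cov.
  - by split=> // r; rewrite mul0n.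
  - rewrite negbK => /msubsetP H; split=> // r; rewrite mul1n -sumE.
    by have := H r; rewrite bigmsetE; under eq_bigr do rewrite mset_seqE.
  - rewrite negb_and potentially_satisfiedE cov /= negbK => /msubsetP H.
    split=> // r; have := H r; rewrite bigmsetE -sumE.
    by under eq_bigr do rewrite restrict_seq; rewrite -big_distrr.
case=> cov H; case: pref H => H; rewrite potentially_satisfiedE cov //=.
  rewrite negbK; apply/msubsetP => r; rewrite bigmsetE.
  under eq_bigr do rewrite mset_seqE.
  by rewrite sumE -[leqLHS]mul1n.
rewrite negb_and negbK; apply/orP; right; apply/msubsetP => r; rewrite bigmsetE.
by under eq_bigr do rewrite restrict_seq; rewrite -big_distrr /= sumE.
Qed.

Definition others i r : nat := \sum_(j | j != i) count_mem r (flatten (pl j)).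
Definition overall r : nat := \sum_j count_mem r (flatten (pl j)).

Lemma overallE i r : overall r = others i r + count_mem r (flatten (pl i)).
Proof. by rewrite /overall (bigD1 i) //= addnC. Qed.

Lemma supply_profile r : supply P r = overall r.
Proof.
by rewrite /supply flat_bag_sum; apply: eq_bigr => j _; rewrite flat_bag_of.
Qed.

Lemma supply_deviate i C r : supply (deviate P i C) r = others i r + flat_bag C r.
Proof.
rewrite /supply flat_bag_sum (bigD1 i) //= addnC /deviate eqxx; congr (_ + _).
by apply: eq_bigr => j /negbTE ->; rewrite flat_bag_of.
Qed.

(** Only resources that [i] contributes are compared with the need: a surplus due to the others
    leaves [i] nothing to withdraw. *)
Definition stable_player i : Prop :=
  let need r := needs pref gl i (forced pref gl i (others i)) r in
  (good_supply pref gl i overall ->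
   forall r, r \in flatten (pl i) -> overall r <= need r) /\
  (~ good_supply pref gl i overall ->
   flatten (pl i) = [::] /\
   ~ forall r, need r <= others i r + count_mem r (flatten (el i))).

Hypothesis barG : is_RCGBAR G.
Hypothesis profP : is_profile G P.

(** Every case asks whether a good contribution exists below some capacity. The capacities are the
    present contribution, the same less one instance, the whole endowment, and the deviation
    itself. *)
Lemma no_deviation i :
  (~ exists C, C `<=` endowment G i /\ strictly_prefers G pref i (deviate P i C) P) <->
  stable_player i.
Proof.
have aE : atomic (bag_of (el i)) by exact: (barG (i := i)).
have aP : atomic (bag_of (pl i)) by apply: atomicS aE; exact: (profP i).
have subE C : C `<=` endowment G i -> atomic C.
  by move=> /atomicS; apply.
have gP : good G pref P i <-> good_supply pref gl i overall.
  by split=> [/goodP|H]; [|apply/goodP; move: H]; apply: good_supply_ext => r; rewrite supply_profile.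
have gD C : good G pref (deviate P i C) i <->
    good_supply pref gl i (fun r => others i r + flat_bag C r).
  by split=> [/goodP|H]; [|apply/goodP; move: H]; apply: good_supply_ext => r; rewrite supply_deviate.
have devi C : deviate P i C i = C by rewrite /deviate eqxx.
(* [good_contribution] for bags: a function below the endowment is realised by an atomic bag. *)
have feasible e : (forall r, e r <= flat_bag (bag_of (el i)) r) ->
    (exists C, [/\ C `<=` endowment G i, forall r, flat_bag C r <= e r &
                  good G pref (deviate P i C) i]) <->
    (forall r, needs pref gl i (forced pref gl i (others i)) r <= others i r + e r).
  move=> le_e; rewrite -good_contribution; split=> [[C [sC le_C /gD gC]]|[c [le_c gc]]].
    by exists (flat_bag C).
  have [|C [aC Cc]] := @flat_bag_inv _ c (bag_of (el i)).
    by move=> r; apply: leq_trans (le_c r) (le_e r).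
  exists C; split.
  - apply/(atomic_msubset aC aE) => r; rewrite Cc.
    exact: leq_trans (le_c r) (le_e r).
  - by move=> r; rewrite Cc.
  - by apply/gD; apply: good_supply_ext gc => r; rewrite Cc.
have le_PE r : flat_bag (P i) r <= flat_bag (bag_of (el i)) r.
  by move: r; apply/(atomic_msubset aP aE); exact: (profP i).
have properC C : atomic C -> C `<` P i <->
    (forall r, flat_bag C r <= flat_bag (P i) r) /\ exists r, flat_bag C r < flat_bag (P i) r.
  move=> aC; rewrite /mproper; split=> [/andP[/(atomic_msubset aC aP) H1 H2]|[H1 [r lt_r]]].
    split=> //; move: H2 => /msubsetP; case: (boolP (has (fun B => C B < P i B) (P i))).
      case/hasP => B /aP[r ->] lt_r _; exists r.
      by rewrite !flat_bag_atomic.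
    move=> /hasPn H2 [] B; have [/H2|/mset_eq0P->//] := boolP (B \in P i).
    by rewrite -leqNgt.
  apply/andP; split; first exact/(atomic_msubset aC aP).
  by apply/negP => /(atomic_msubset aP aC) /(_ r); rewrite leqNgt lt_r.
case gi: (good G pref P i).
  have gi' := gi; move/gP: gi' => gt; split.
    move=> no; split=> // _ r rP; rewrite leqNgt; apply/negP => lt_r; apply: no.
    (* One instance of [r] is withdrawn. The surplus in [r] keeps the needs within this capacity, so
       a good contribution strictly below the present one exists. *)
    pose e x := flat_bag (P i) x - (x == r).
    have /feasible[_ /(_ _)] : forall x, e x <= flat_bag (bag_of (el i)) x.
      by move=> x; apply: leq_trans (le_PE x); rewrite leq_subr.
    case.
      have H x : needs pref gl i (forced pref gl i (others i)) x <= overall x.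
        have /feasible[H _] := le_PE; rewrite (overallE i) -flat_bag_of; move: x; apply: H.
        exists (P i); split=> //.
        by apply/gD; apply: good_supply_ext gt => x; rewrite (overallE i) flat_bag_of.
      move=> x; move: (H x) lt_r; rewrite !(overallE i) /e flat_bag_of.
      by case: eqP => [->|_] /=; lia.
    move=> C [sC le_C gC]; exists C; split=> //.
    rewrite /strictly_prefers gC gi /= devi; apply/(properC _ (subE _ sC)); split.
      by move=> x; apply: leq_trans (le_C x) _; rewrite leq_subr.
    exists r; apply: leq_ltn_trans (le_C r) _.
    by rewrite /e eqxx flat_bag_of; move: rP; rewrite -has_pred1 has_count; lia.
  case=> /(_ gt) st _ [C [sC]]; rewrite /strictly_prefers gi /= !andbF /=.
  (* A good [C] strictly below the present contribution still meets the needs, so where it is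
     smaller the present supply exceeds the need, against stability. *)
  rewrite devi => /andP[gC /(properC _ (subE _ sC))[le_C [r lt_r]]].
  have /feasible[/(_ _)] : forall x, flat_bag C x <= flat_bag (bag_of (el i)) x.
    by move=> x; apply: leq_trans (le_C x) (le_PE x).
  move=> H _; have {}H : forall x,
      needs pref gl i (forced pref gl i (others i)) x <= others i x + flat_bag C x.
    by apply: H; exists C.
  have rP : r \in flatten (pl i).
    by rewrite -has_pred1 has_count -flat_bag_of; apply: leq_ltn_trans lt_r.
  by have := st r rP; move: (H r) lt_r; rewrite (overallE i) flat_bag_of; lia.
have ngt : ~ good_supply pref gl i overall by move=> /gP; rewrite gi.
split.
  move=> no; split=> // _.
  have P0 : flatten (pl i) = [::].
    (* Withdrawing everything is an improvement whether or not the result is good: either it becomes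
       good or it is a smaller bad choice. *)
    apply/eqP/negPn/negP => nP; apply: no; exists mset0.
    have s0 : (mset0 : bag Res) `<=` endowment G i by exact: msub0set.
    split=> //; rewrite /strictly_prefers gi devi.
    case: (good _ _ _ _) => //=; rewrite orbF.
    apply/(properC _ (subE _ s0)); split=> [r|]; first by rewrite flat_bag0.
    case: (flatten _) (@flat_bag_of _ (pl i)) nP => // r s /(_ r) e _; exists r.
    by rewrite flat_bag0 e /= eqxx.
  split=> // H; apply: no.
  have [_ /(_ _)] := feasible _ (fun r => leqnn (flat_bag (bag_of (el i)) r)).
  case=> [r|C [sC _ gC]]; first by rewrite flat_bag_of.
  by exists C; split=> //; rewrite /strictly_prefers gC gi.
case=> _ /(_ ngt)[P0 nH] [C [sC]]; rewrite /strictly_prefers gi /= devi andbF orbF.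
case/orP => [/andP[_ /(properC _ (subE _ sC))[_ [r]]]|/andP[gC _]].
  by rewrite flat_bag_of P0.
apply: nH => r; rewrite -flat_bag_of; move: r.
apply/(feasible _ (fun r => leqnn (flat_bag (bag_of (el i)) r))).
exists C; split=> //; exact/(atomic_msubset (subE _ sC) aE).
Qed.

Lemma is_NE_stable : is_NE G pref P <-> forall i, stable_player i.
Proof.
split=> [[_ no] i|st]; first by apply/no_deviation => -[C HC]; apply: no; exists i, C.
by split=> // -[i [C HC]]; have /(no_deviation i)[] := st i; exists C.
Qed.
End Equilibrium.

(** * The decision procedure on lists *)

Section Checker.
Variables (T : eqType) (pref : preference).
Implicit Types (s t g p e out h : seq T) (S goals : seq (seq T)).

Definition included s t : bool := all (fun r => count_mem r s <= count_mem r t) s.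

Definition demand g S : seq T := [seq r <- flatten S | counted pref g r].

Definition good_list goals out g : bool :=
  included g out && included (demand g [seq h <- goals | included h out]) out.

(** The three alternatives express the maximum in [satisfiable]. The supply of the others is [out]
    without [p]; adding [p] on the left avoids a subtraction. *)
Definition supplied g p out S h : bool :=
  all (fun r => [|| count_mem r (h ++ p) <= count_mem r out,
                    count_mem r h <= count_mem r g |
                    count_mem r h <= count_mem r (demand g S)]) h.

(** The fold ignores the entries of [goals]; their number is the number of players, hence of
    iterations. Goals can stand for players because being satisfied depends on the goal alone. *)
Definition forced_list g p out goals : seq (seq T) :=
  foldl (fun S _ => [seq h <- goals | supplied g p out S h]) [::] goals.

(** In the bad case the second test matters only if [p] is empty, and then [out] is the supply of
    the others. *)
Definition stable_list goals out (x : seq T * (seq T * seq T)) : bool :=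
  let: (g, (e, p)) := x in
  let d := demand g (forced_list g p out goals) in
  if good_list goals out g then
    all (fun r => (count_mem r out <= count_mem r g) ||
                  (count_mem r out <= count_mem r d)) p
  else nilp p && ~~ (included g (out ++ e) && included d (out ++ e)).

Definition equilibrium (players : seq (seq T * (seq T * seq T))) : bool :=
  all (stable_list [seq x.1 | x <- players] (flatten [seq x.2.2 | x <- players]))
      players.

Lemma includedP s t : reflect (forall r, count_mem r s <= count_mem r t) (included s t).
Proof.
apply: (iffP allP) => [H r|H r _]; last exact: H.
by have [/H//|/count_memPn ->] := boolP (r \in s).
Qed.

Lemma count_demand n (gl : 'I_n -> seq T) (Q : pred 'I_n) g r :
  count_mem r (demand g [seq gl j | j <- enum 'I_n & Q j]) =
  counted pref g r * \sum_(j | Q j) count_mem r (gl j).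
Proof.
rewrite count_filter; case c: (counted pref g r); last first.
  rewrite mul0n; apply/eqP; rewrite -leqn0 leqNgt -has_count; apply/hasPn => x _ /=.
  by case: eqP => // ->; rewrite c.
rewrite mul1n (@eq_count _ _ (pred1 r)); last by move=> x /=; case: eqP => // ->.
by rewrite count_flatten sumnE big_map big_map big_filter big_enum_cond.
Qed.
End Checker.

(** * Correctness of the list procedure *)

Section CheckerCorrect.
Variables (Res : choiceType) (n : nat) (pref : preference).
Variables (gl : 'I_n -> seq Res) (el pl : 'I_n -> seq (seq Res)).

Let players := [seq (gl i, (flatten (el i), flatten (pl i))) | i <- enum 'I_n].
Let goals := [seq gl i | i <- enum 'I_n].
Let out := flatten [seq flatten (pl i) | i <- enum 'I_n].

Lemma count_out r : count_mem r out = overall pl r.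
Proof. by rewrite count_flatten sumnE big_map big_map big_enum. Qed.

Lemma good_listP i :
  reflect (good_supply pref gl i (overall pl)) (good_list pref goals out (gl i)).
Proof.
have covE j : included (gl j) out = covers gl (overall pl) j.
  by apply: eq_all => r; rewrite count_out.
have claimE r : count_mem r (demand pref (gl i) [seq h <- goals | included h out]) =
    claims pref gl i (overall pl) r.
  by rewrite filter_map count_demand; congr (_ * _); apply: eq_bigl => j /=; rewrite covE.
apply: (iffP andP); rewrite covE => -[H1 H2]; split=> //.
  by move=> r; move/includedP/(_ r): H2; rewrite claimE count_out.
by apply/includedP => r; rewrite claimE count_out.
Qed.

Lemma forced_listE i :
  forced_list pref (gl i) (flatten (pl i)) out goals =
  [seq gl j | j <- enum 'I_n & j \in forced pref gl i (others pl i)].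
Proof.
rewrite /forced_list /forced.
have foldlE (A B : Type) (f : A -> A) (s : seq B) x : foldl (fun y _ => f y) x s = iter (size s) f x.
  by elim: s x => //= b s IH x; rewrite IH -iterSr.
rewrite foldlE size_map size_enum_ord.
set f := fun y => _; set h := satisfiable _ _ _ _.
suff H k : iter k f [::] = [seq gl j | j <- enum 'I_n & j \in iter k h set0] by exact: H.
elim: k => [|k IH].
  by rewrite /= (eq_filter (a2 := pred0)) ?filter_pred0 // => j; rewrite inE.
rewrite /= IH {IH} /f; set S := iter k _ _.
rewrite filter_map; congr map; apply: eq_filter => j /=; rewrite /h inE.
apply: eq_all => r; rewrite count_demand count_cat count_out (overallE pl i) /needs.
by rewrite leq_add2r !leq_max.
Qed.

Lemma stable_listP i :
  reflect (stable_player pref gl el pl i)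
    (stable_list pref goals out (gl i, (flatten (el i), flatten (pl i)))).
Proof.
rewrite /stable_list forced_listE.
set F := forced _ _ _ _; set d := demand _ _ _.
have needE r : needs pref gl i F r = maxn (count_mem r (gl i)) (count_mem r d).
  by rewrite count_demand.
case: good_listP => gi; last first.
  apply: (iffP andP) => [[/nilP p0 nf]|[_ /(_ gi)[p0 nf]]]; split=> //.
  - move=> _; split=> // H; move/negP: nf; apply; apply/andP.
    by split; apply/includedP => r; have := H r;
      rewrite needE geq_max count_cat count_out (overallE pl i) p0 addn0 => /andP[].
  - by rewrite p0.
  - apply/negP => /andP[/includedP H1 /includedP H2]; apply: nf => r.
    have := H1 r; have := H2 r; rewrite needE geq_max count_cat count_out (overallE pl i).
    by rewrite p0 addn0 => -> ->.
apply: (iffP allP) => [H|[/(_ gi) H _] r rp]; [split=> // _ r rp|].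
  by rewrite needE leq_max -count_out; apply: H.
by have := H r rp; rewrite needE leq_max -count_out.
Qed.

Lemma equilibriumP :
  is_RCGBAR (listed_game gl el) ->
  is_profile (listed_game gl el) (listed_profile pl) ->
  reflect (is_NE (listed_game gl el) pref (listed_profile pl)) (equilibrium pref players).
Proof.
have eg : [seq x.1 | x <- players] = goals by rewrite /players -map_comp.
have eo : flatten [seq x.2.2 | x <- players] = out by rewrite /players -map_comp.
move=> bar prof; rewrite /equilibrium eg eo; apply: (iffP allP) => [H|].
  apply/is_NE_stable => // i; apply/stable_listP; apply: H.
  by apply: map_f; rewrite mem_enum.
by move/(is_NE_stable pref bar prof) => H x /mapP[i _ ->]; apply/stable_listP.
Qed.
End CheckerCorrect.

(** * Invariance under injective renaming of resources *)

Section Renaming.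
Variables (T U : eqType) (f : T -> U) (pref : preference).
Hypothesis f_inj : injective f.

Lemma count_mem_map r (s : seq T) : count_mem (f r) [seq f x | x <- s] = count_mem r s.
Proof. by rewrite count_map; apply: eq_count => x /=; rewrite (inj_eq f_inj). Qed.

Lemma included_map s t : included [seq f x | x <- s] [seq f x | x <- t] = included s t.
Proof. by rewrite /included all_map; apply: eq_all => r /=; rewrite !count_mem_map. Qed.

Lemma demand_map g S :
  demand pref [seq f x | x <- g] [seq [seq f x | x <- s] | s <- S] =
  [seq f x | x <- demand pref g S].
Proof.
rewrite /demand -map_flatten filter_map; congr map; apply: eq_filter => r.
by rewrite /counted /=; case: pref => //; rewrite (mem_map f_inj).
Qed.

Lemma good_list_map goals out g :
  good_list pref [seq [seq f x | x <- s] | s <- goals] [seq f x | x <- out]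
    [seq f x | x <- g] = good_list pref goals out g.
Proof.
rewrite /good_list included_map filter_map demand_map included_map.
by congr (_ && included (demand _ _ _) _); apply: eq_filter => h; rewrite /= included_map.
Qed.

Lemma forced_list_map g p out goals :
  forced_list pref [seq f x | x <- g] [seq f x | x <- p] [seq f x | x <- out]
    [seq [seq f x | x <- s] | s <- goals] =
  [seq [seq f x | x <- s] | s <- forced_list pref g p out goals].
Proof.
rewrite /forced_list; set F' := fun S _ => _; set F := fun S _ => _.
suff H l S : foldl F' [seq [seq f x | x <- s] | s <- S] [seq [seq f x | x <- s] | s <- l] =
    [seq [seq f x | x <- s] | s <- foldl F S l] by exact: (H goals [::]).
elim: l S => //= h s IH S; rewrite -IH; congr foldl; rewrite /F' /F.
rewrite filter_map; congr map; apply: eq_filter => k /=; rewrite /supplied all_map.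
by apply: eq_all => r /=; rewrite -map_cat demand_map !count_mem_map.
Qed.

Lemma stable_list_map goals out g e p :
  stable_list pref [seq [seq f x | x <- s] | s <- goals] [seq f x | x <- out]
    ([seq f x | x <- g], ([seq f x | x <- e], [seq f x | x <- p])) =
  stable_list pref goals out (g, (e, p)).
Proof.
rewrite /stable_list good_list_map forced_list_map demand_map -map_cat !included_map.
rewrite all_map /nilp size_map; case: good_list => //.
by apply: eq_all => r /=; rewrite !count_mem_map.
Qed.

(** Applied to [val], this transfers the verdict on names to the game over [seq_sub (types d)]. *)
Lemma equilibrium_map (players : seq (seq T * (seq T * seq T))) :
  equilibrium pref [seq ([seq f x | x <- a.1],
                         ([seq f x | x <- a.2.1], [seq f x | x <- a.2.2])) | a <- players] =
  equilibrium pref players.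
Proof.
set fs := fun s : seq T => [seq f x | x <- s]; set ps := map _ players.
rewrite /equilibrium.
have -> : flatten [seq x.2.2 | x <- ps] = fs (flatten [seq x.2.2 | x <- players]).
  by rewrite /fs map_flatten -!map_comp.
have -> : [seq x.1 | x <- ps] = [seq fs s | s <- [seq x.1 | x <- players]].
  by rewrite -!map_comp.
by rewrite all_map; apply: eq_all => -[g [e p]]; apply: stable_list_map.
Qed.
End Renaming.

(** * Encoding and decoding instances *)

(** Texts replace the dependent type [instance] by plain lists of names, which have codes. *)
Definition bundle_text := seq bitseq.
Definition bag_text := seq bundle_text.
(* The resource types, the goals and endowments, and the profile. *)
Definition text := (seq bitseq * (seq (bundle_text * bag_text) * seq bag_text))%type.

Definition write_bundle : bundle_text -> seq symbol := enc_list enc_name.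
Definition write_bag : bag_text -> seq symbol := enc_list write_bundle.
Definition write_player (p : bundle_text * bag_text) : seq symbol :=
  bracket (write_bundle p.1 ++ write_bag p.2).
Definition write_text (t : text) : seq symbol :=
  enc_list enc_name t.1 ++ enc_list write_player t.2.1 ++ enc_list write_bag t.2.2.

Definition text_of (d : instance) : text :=
  (types d,
   ([seq ([seq val r | r <- p.1], [seq [seq val r | r <- b] | b <- p.2]) | p <- game_list d],
    [seq [seq [seq val r | r <- b] | b <- x] | x <- profile_list d])).

Lemma enc_list_map A B (f : A -> B) (enc : B -> seq symbol) s :
  enc_list enc [seq f x | x <- s] = enc_list (enc \o f) s.
Proof. by rewrite /enc_list -map_comp. Qed.

Lemma eq_enc_list A (enc enc' : A -> seq symbol) : enc =1 enc' -> enc_list enc =1 enc_list enc'.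
Proof. by move=> e s; rewrite /enc_list (eq_map e). Qed.

Lemma write_text_of d : write_text (text_of d) = enc_instance d.
Proof.
have bundleE ts (b : seq (seq_sub ts)) : write_bundle [seq val r | r <- b] = enc_bundle b.
  by rewrite /write_bundle enc_list_map.
have bagE ts (x : seq (seq (seq_sub ts))) :
    write_bag [seq [seq val r | r <- b] | b <- x] = enc_bag x.
  by rewrite /write_bag enc_list_map; apply: eq_enc_list => b; apply: bundleE.
rewrite /write_text /enc_instance; congr (_ ++ (_ ++ _)).
  rewrite enc_list_map; apply: eq_enc_list => p.
  by congr (bracket (_ ++ _)); [apply: bundleE | apply: bagE].
by rewrite enc_list_map; apply: eq_enc_list => x; apply: bagE.
Qed.

Definition single (T : Type) (s : seq T) : bool := ~~ nilp s && nilp (behead s).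

Section Validity.
Variable T : eqType.
Implicit Types x : (seq T * seq (seq T)) * seq (seq T).

Definition valid_player x : bool :=
  [&& all (@single T) x.1.2, all (@single T) x.2 & included (flatten x.2) (flatten x.1.2)].

Definition summary x : seq T * (seq T * seq T) := (x.1.1, (flatten x.1.2, flatten x.2)).
End Validity.

Definition known (ts : seq bitseq) (x : (bundle_text * bag_text) * bag_text) : bool :=
  all (fun r => r \in ts) (x.1.1 ++ flatten x.1.2 ++ flatten x.2).

(** These are the texts of instances: one profile entry per player, and only declared names. *)
Definition well_formed (t : text) : bool :=
  (size t.2.1 == size t.2.2) && all (known t.1) (zip t.2.1 t.2.2).

Definition valid (pref : preference) (t : text) : bool :=
  let xs := zip t.2.1 t.2.2 in
  all (@valid_player _) xs && equilibrium pref [seq summary x | x <- xs].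

Lemma map_surjective (A : Type) (B : eqType) (f : A -> B) (s : seq B) :
  (forall b, b \in s -> exists a, f a = b) -> exists s', [seq f x | x <- s'] = s.
Proof.
elim: s => [|b s IH] H; first by exists [::].
have [a <-] := H b (mem_head _ _).
have [|s' <-] := IH; first by move=> c cs; apply: H; rewrite inE cs orbT.
by exists (a :: s').
Qed.

Lemma well_formed_text_of t : well_formed t -> exists d, text_of d = t.
Proof.
case: t => ts [gs ps] /andP[/eqP /= sz /allP kn].
have bundleP b : {subset b <= ts} -> exists b' : seq (seq_sub ts), [seq val r | r <- b'] = b.
  by move=> sb; apply: map_surjective => r /sb rs; exists (SeqSub rs).
have bagP x : {subset flatten x <= ts} ->
    exists x' : seq (seq (seq_sub ts)), [seq [seq val r | r <- b] | b <- x'] = x.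
  move=> sx; apply: map_surjective => b bx; apply: bundleP => r rb.
  by apply: sx; apply/flattenP; exists b.
(* Equal sizes guarantee that each entry appears in the zipped list, at its own index. *)
have kng p : p \in gs -> {subset p.1 ++ flatten p.2 <= ts}.
  move=> pg r rp; have ip : index p gs < size gs by rewrite index_mem.
  have := kn (nth (p, [::]) (zip gs ps) (index p gs)).
  rewrite mem_nth ?size1_zip -?sz // nth_zip // nth_index // => /(_ isT) /allP; apply.
  by rewrite catA mem_cat rp.
have knp x : x \in ps -> {subset flatten x <= ts}.
  move=> xp r rx; have ix : index x ps < size ps by rewrite index_mem.
  have := kn (nth (([::], [::]), x) (zip gs ps) (index x ps)).
  rewrite mem_nth ?size1_zip ?sz // nth_zip // nth_index // => /(_ isT) /allP; apply.
  by rewrite !mem_cat rx !orbT.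
have [gs' Eg] : exists gs' : seq (seq (seq_sub ts) * seq (seq (seq_sub ts))),
    [seq ([seq val r | r <- p.1], [seq [seq val r | r <- b] | b <- p.2]) | p <- gs'] = gs.
  apply: map_surjective => -[b x] /kng sp.
  have [|b' Eb] := bundleP b; first by move=> r rb; apply: sp; rewrite mem_cat rb.
  have [|x' Ex] := bagP x; first by move=> r rx; apply: sp; rewrite mem_cat rx orbT.
  by exists (b', x'); rewrite /= Eb Ex.
have [ps' Ep] : exists ps' : seq (seq (seq (seq_sub ts))),
    [seq [seq [seq val r | r <- b] | b <- x] | x <- ps'] = ps.
  by apply: map_surjective => x /knp; apply: bagP.
have sz' : size ps' == size gs'.
  by have := congr1 size Ep; have := congr1 size Eg; rewrite !size_map sz => -> ->.
by exists (Instance (in_tuple gs') (Tuple sz')); rewrite /text_of /= Eg Ep.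
Qed.

Lemma singleP (T : choiceType) (b : seq T) :
  reflect (exists r, seq_mset b = [mset r]) (single b).
Proof.
apply: (iffP idP) => [|[r e]].
  case: b => [|r [|]] // _; exists r; apply/msetP => x.
  by rewrite mset_seqE msetnE /= addn0 eq_sym; case: eqP.
have /perm_size := perm_eq_seq_mset b; rewrite e enum_msetn /=.
by case: b {e} => [|x [|]].
Qed.

Lemma all_enum n (Q : pred 'I_n) : reflect (forall i, Q i) (all Q (enum 'I_n)).
Proof. by apply: (iffP allP) => H i //; apply: H; rewrite mem_enum. Qed.

Lemma zip_text_of d :
  let v (s : seq (seq_sub (types d))) := [seq val r | r <- s] in
  zip (text_of d).2.1 (text_of d).2.2 =
  [seq ((v (tnth (game_list d) i).1, [seq v b | b <- (tnth (game_list d) i).2]),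
        [seq v b | b <- tnth (profile_list d) i]) | i <- enum 'I_(players d)].
Proof.
rewrite /text_of /= -[in LHS](map_tnth_enum (game_list d)).
by rewrite -[in LHS](map_tnth_enum (profile_list d)) -!map_comp zip_map.
Qed.

Lemma valid_text_of pref d :
  [/\ is_RCGBAR (game_of d), is_profile (game_of d) (@profile_of d) &
      is_NE (game_of d) pref (@profile_of d)] <-> valid pref (text_of d).
Proof.
pose gl i := (tnth (game_list d) i).1.
pose el i := (tnth (game_list d) i).2.
pose pl i := tnth (profile_list d) i.
rewrite -[game_of d]/(listed_game gl el) -[@profile_of d]/(listed_profile pl).
pose v (s : seq (seq_sub (types d))) := [seq val r | r <- s].
have zipE := zip_text_of d.
have flatE x : flatten [seq v b | b <- x] = v (flatten x) by rewrite /v map_flatten.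
have validE : valid pref (text_of d) =
    all (fun i => valid_player ((gl i, el i), pl i)) (enum 'I_(players d)) &&
    equilibrium pref [seq (gl i, (flatten (el i), flatten (pl i))) | i <- enum 'I_(players d)].
  rewrite /valid zipE all_map; congr (_ && _).
    apply: eq_all => i; rewrite /= /valid_player /= !all_map !flatE included_map; last exact: val_inj.
    have sE b : single (v b) = single b by case: b => [|? [|]].
    by congr [&& _, _ & _]; apply: eq_all => b; apply: sE.
  rewrite -(equilibrium_map (f := val)); last exact: val_inj.
  rewrite -!map_comp; congr equilibrium; apply: eq_map => i.
  by rewrite /summary /= !flatE.
rewrite validE.
have barP : is_RCGBAR (listed_game gl el) <-> forall i, all (@single _) (el i).
  split=> [bar i|sg i B].
    apply/allP => b bi; apply/singleP; apply: (bar i).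
    by rewrite (perm_mem (perm_eq_seq_mset _)); apply: map_f.
  rewrite (perm_mem (perm_eq_seq_mset _)) => /mapP[b bi ->].
  by apply/singleP; apply: (allP (sg i)).
(* Comparing flattenings is equivalent to comparing bags only for atomic bags; the profile inherits
   atomicity from the endowments or gets it from the test. *)
have profP : is_RCGBAR (listed_game gl el) ->
    is_profile (listed_game gl el) (listed_profile pl) <->
    forall i, all (@single _) (pl i) && included (flatten (pl i)) (flatten (el i)).
  move=> bar; split=> [prof i|H i].
    have aE : atomic (bag_of (el i)) by exact: (bar i).
    have aP : atomic (bag_of (pl i)) by apply: atomicS aE; exact: (prof i).
    apply/andP; split.
      apply/allP => b bi; apply/singleP; apply: aP.
      by rewrite (perm_mem (perm_eq_seq_mset _)); apply: map_f.
    apply/includedP => r; rewrite -!flat_bag_of; move: r.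
    by apply/(atomic_msubset aP aE); exact: (prof i).
  have /andP[/allP sg /includedP inc] := H i.
  have aE : atomic (bag_of (el i)) by exact: (bar i).
  have aP : atomic (bag_of (pl i)).
    move=> B; rewrite (perm_mem (perm_eq_seq_mset _)) => /mapP[b bi ->].
    by apply/singleP; apply: sg.
  by apply/(atomic_msubset aP aE) => r; rewrite !flat_bag_of.
split=> [[bar prof NE]|/andP[/all_enum H eq]].
  apply/andP; split; last by apply/(equilibriumP pref bar prof).
  apply/all_enum => i; rewrite /valid_player /=.
  have -> : all (@single _) (el i) by exact: (barP.1 bar i).
  exact: ((profP bar).1 prof i).
have bar : is_RCGBAR (listed_game gl el).
  by apply/barP => i; have /and3P[] := H i.
have prof : is_profile (listed_game gl el) (listed_profile pl).
  by apply/profP => // i; have /and3P[_ -> ->] := H i.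
by split=> //; apply/(equilibriumP pref bar prof).
Qed.

Lemma well_formed_of d : well_formed (text_of d).
Proof.
rewrite /well_formed /= !size_map !size_tuple eqxx /=.
have valsP (b : seq (seq_sub (types d))) r : r \in [seq val x | x <- b] -> r \in types d.
  by case/mapP => x _ ->; apply: valP.
have bagP (x : seq (seq (seq_sub (types d)))) r :
    r \in flatten [seq [seq val r | r <- b] | b <- x] -> r \in types d.
  by rewrite -map_flatten; apply: valsP.
rewrite zip_text_of; apply/allP => x /mapP[i _ ->]; apply/allP => r.
by rewrite !mem_cat => /or3P[/valsP|/bagP|/bagP].
Qed.

(** With instances eliminated, membership becomes two Boolean conditions on a text that writes to
    [w]. *)
Lemma NE_checkingE pref w :
  NE_checking pref w <-> exists t, [/\ w = write_text t, well_formed t & valid pref t].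
Proof.
split=> [[d [-> bar prof NE]]|[t [-> /well_formed_text_of[d <-] ok]]].
  exists (text_of d); split; first by rewrite write_text_of.
    exact: well_formed_of.
  exact/valid_text_of.
by exists d; have [bar prof NE] := (valid_text_of pref d).2 ok; rewrite write_text_of.
Qed.

(** * Parsing without error checking *)

Definition nested (l : seq sexp) : sexp := spine None l.

(* The word is read backwards; the second component holds the unfinished lists
   that surround the current one. *)
Definition parse_step (st : seq sexp * seq (seq sexp)) (x : symbol) :
    seq sexp * seq (seq sexp) :=
  match x with
  | inl b => (Atom (Some b) :: st.1, st.2)
  | inr false => ([::], st.1 :: st.2)
  | inr true => (nested st.1 :: head [::] st.2, behead st.2)
  end.

(** The state in which parsing starts is arbitrary, so that concatenation and brackets follow by
    composing runs. *)
Definition parses (w : seq symbol) (l : seq sexp) : Prop :=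
  forall t r, foldl parse_step (t, r) (rev w) = (l ++ t, r).

Lemma parses_bit b : parses [:: inl b] [:: Atom (Some b)].
Proof. by []. Qed.

Lemma parses_cat w w' l l' : parses w l -> parses w' l' -> parses (w ++ w') (l ++ l').
Proof. by move=> H H' t r; rewrite rev_cat foldl_cat H' H catA. Qed.

Lemma parses_bracket w l : parses w l -> parses (bracket w) [:: nested l].
Proof.
move=> H t r; rewrite /bracket rev_cons rev_rcons -cats1 /= foldl_cat H /=.
by rewrite cats0.
Qed.

Lemma parses_flatten (T : Type) (enc : T -> seq symbol) (tree : T -> sexp) s :
  (forall x, parses (enc x) [:: tree x]) ->
  parses (flatten [seq enc x | x <- s]) [seq tree x | x <- s].
Proof. by move=> H; elim: s => [|x s IH] //=; apply: (parses_cat (H x) IH). Qed.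

Lemma parses_list (T : Type) (enc : T -> seq symbol) (tree : T -> sexp) s :
  (forall x, parses (enc x) [:: tree x]) ->
  parses (enc_list enc s) [:: nested [seq tree x | x <- s]].
Proof. by move=> H; apply/parses_bracket/parses_flatten. Qed.

Definition read_name (x : sexp) : bitseq := [seq sexp_true y | y <- items x].
Definition read_bundle (x : sexp) : bundle_text := [seq read_name y | y <- items x].
Definition read_bag (x : sexp) : bag_text := [seq read_bundle y | y <- items x].
Definition item (k : nat) (l : seq sexp) : sexp := head (Atom None) (iter k behead l).
Definition read_player (x : sexp) : bundle_text * bag_text :=
  (read_bundle (item 0 (items x)), read_bag (item 1 (items x))).
Definition read_text (l : seq sexp) : text :=
  ([seq read_name x | x <- items (item 0 l)],
   ([seq read_player x | x <- items (item 1 l)], [seq read_bag x | x <- items (item 2 l)])).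

Lemma items_nested l : items (nested l) = l.
Proof. by elim: l => //= x l ->. Qed.

Section Reading.
Variables (T : Type) (enc : T -> seq symbol) (read : sexp -> T).

(** The intermediate tree is existentially quantified: only its recovery by [read] matters when
    readers are nested. *)
Definition reads : Prop :=
  exists2 tree, forall x, parses (enc x) [:: tree x] & cancel tree read.

Lemma reads_list : reads ->
  exists2 tree, forall s, parses (enc_list enc s) [:: tree s] &
    cancel tree (fun x => [seq read y | y <- items x]).
Proof.
case=> tree H K; exists (fun s => nested [seq tree x | x <- s]) => s; first exact: parses_list.
by rewrite items_nested mapK.
Qed.
End Reading.

Lemma reads_name : reads enc_name read_name.
Proof.
exists (fun b => nested [seq Atom (Some x) | x <- b]) => b.
  apply: parses_bracket; rewrite -[[seq inl x | x <- b]]flatten_seq1.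
  by rewrite -map_comp; apply: parses_flatten => x; apply: parses_bit.
by rewrite /read_name items_nested -map_comp; apply: map_id_in; case.
Qed.

Lemma reads_bag : reads write_bag read_bag.
Proof. by do 2!apply: reads_list; apply: reads_name. Qed.

Lemma reads_player : reads write_player read_player.
Proof.
have [tb pb Kb] := reads_list reads_name; have [tx px Kx] := reads_bag.
exists (fun p => nested [:: tb p.1; tx p.2]) => [p|[b x]].
  by apply/parses_bracket/(parses_cat (pb _) (px _)).
by rewrite /read_player /item /= Kx; congr (_, _); apply: Kb.
Qed.

Lemma read_write_text t :
  read_text (foldl parse_step ([::], [::]) (rev (write_text t))).1 = t.
Proof.
have [tn pn Kn] := reads_list reads_name.
have [tg pg Kg] := reads_list reads_player.
have [tp pp Kp] := reads_list reads_bag.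
rewrite (parses_cat (pn _) (parses_cat (pg _) (pp _))) /read_text /item /=.
by case: t => ts [gs ps]; congr (_, (_, _)); [apply: Kn | apply: Kg | apply: Kp].
Qed.

(** The argument is the reversed word, which is both what [load] produces and the order in which the
    parser consumes symbols. *)
Definition check_reversed (pref : preference) (u : seq symbol) : bool :=
  let t := read_text (foldl parse_step ([::], [::]) u).1 in
  [&& write_text t == rev u, well_formed t & valid pref t].

Lemma check_reversedP pref w :
  reflect (NE_checking pref w) (check_reversed pref (rev w)).
Proof.
apply: (iffP and3P); rewrite revK.
  by case=> /eqP e wf ok; apply/NE_checkingE; eexists; split; [exact: esym e | |].
by case/NE_checkingE => t [-> wf ok]; rewrite read_write_text.
Qed.

(** * The cost of the decision procedure *)

(* The concatenation comes before the constructors, with which it unifies after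
   unfolding. *)
Ltac polytime_list_step :=
  first
    [ polytime_known | apply: polytime_cat | apply: polytime_flatten
    | apply: polytime_rev | apply: polytime_items | apply: polytime_leq
    | polytime_step ].

Ltac polytime_auto := repeat polytime_list_step.

Lemma polytime_name_eq : polytime (fun x : bitseq * bitseq => x.1 == x.2).
Proof. by apply: polytime_eq_seq; polytime_auto. Qed.

Section Names.
Context {C : Type} {codC : codable C}.

Lemma polytime_count_mem (r : C -> bitseq) (s : C -> seq bitseq) :
  polytime r -> polytime s -> polytime (fun c => count_mem (r c) (s c)).
Proof.
move=> pr ps; apply: (polytime_count (p := fun x : C * bitseq => x.2 == r x.1)) => //.
apply: (polytime_comp polytime_name_eq (g := fun x => (x.2, r x.1))); polytime_auto.
Qed.

Lemma polytime_mem (r : C -> bitseq) (s : C -> seq bitseq) :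
  polytime r -> polytime s -> polytime (fun c => r c \in s c).
Proof.
move=> pr ps; apply: (@eq_polytime _ _ _ _ (fun c => 1 <= count_mem (r c) (s c))).
  by move=> c; rewrite -has_count has_pred1.
by polytime_auto; apply: polytime_count_mem.
Qed.
End Names.

Ltac polytime_names :=
  repeat first [ polytime_list_step | apply: polytime_count_mem | apply: polytime_mem ].

Section CheckerCost.
Context {C : Type} {codC : codable C}.
Variable pref : preference.

Lemma polytime_included (s t : C -> seq bitseq) :
  polytime s -> polytime t -> polytime (fun c => included (s c) (t c)).
Proof.
move=> ps pt.
apply: (polytime_all (p := fun x : C * bitseq =>
  count_mem x.2 (s x.1) <= count_mem x.2 (t x.1))); polytime_names.
Qed.

Lemma polytime_demand (g : C -> seq bitseq) (S : C -> seq (seq bitseq)) :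
  polytime g -> polytime S -> polytime (fun c => demand pref (g c) (S c)).
Proof.
move=> pg pS.
apply: (polytime_filter (p := fun x : C * bitseq => counted pref (g x.1) x.2)); last by polytime_auto.
by case: pref; rewrite /counted; polytime_names.
Qed.
End CheckerCost.

Ltac polytime_lists :=
  repeat first [ polytime_list_step | apply: polytime_count_mem | apply: polytime_mem
    | apply: polytime_included | apply: polytime_demand ].

Section CheckerCost.
Context {C : Type} {codC : codable C}.
Variable pref : preference.

Lemma polytime_good_list (goals : C -> seq (seq bitseq)) (out g : C -> seq bitseq) :
  polytime goals -> polytime out -> polytime g ->
  polytime (fun c => good_list pref (goals c) (out c) (g c)).
Proof.
move=> pgs po pg; rewrite /good_list; polytime_lists.
apply: (polytime_filter (p := fun x : C * seq bitseq => included x.2 (out x.1))); polytime_lists.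
Qed.

Lemma polytime_supplied (g p out : C -> seq bitseq) (S : C -> seq (seq bitseq)) (h : C -> seq bitseq) :
  polytime g -> polytime p -> polytime out -> polytime S -> polytime h ->
  polytime (fun c => supplied pref (g c) (p c) (out c) (S c) (h c)).
Proof.
move=> pg pp po pS ph.
apply: (polytime_all (p := fun x : C * bitseq =>
  [|| count_mem x.2 (h x.1 ++ p x.1) <= count_mem x.2 (out x.1),
      count_mem x.2 (h x.1) <= count_mem x.2 (g x.1) |
      count_mem x.2 (h x.1) <= count_mem x.2 (demand pref (g x.1) (S x.1))])); polytime_lists.
Qed.

End CheckerCost.

Section CheckerCost.
Context {C : Type} {codC : codable C}.
Variable pref : preference.

Lemma weight_filter (A : Type) (codA : codable A) (Q : pred A) (s : seq A) :
  weight (code [seq x <- s | Q x]) <= weight (code s).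
Proof.
by elim: s => //= x s IH; case: (Q x); rewrite !weight_cons; lia.
Qed.

(** Each iterate is a sublist of [goals], so its weight is bounded by the fixed data, whatever the
    accumulator was. *)
Lemma polytime_forced_list (g p out : C -> seq bitseq) (goals : C -> seq (seq bitseq)) :
  polytime g -> polytime p -> polytime out -> polytime goals ->
  polytime (fun c => forced_list pref (g c) (p c) (out c) (goals c)).
Proof.
move=> pg pp po pgs; have [q T pT HT] := pgs.
pose f (x : C * (seq bitseq * seq (seq bitseq))) :=
  [seq h <- goals x.1 | supplied pref (g x.1) (p x.1) (out x.1) x.2.2 h].
apply: (polytime_fold_seq (g := f) pT) => //; last exact: polytime_const.
  move=> c a S; rewrite /f /= (leq_trans (weight_filter _ _ _)) //.
  have [_ H] := HT c; apply: leq_trans H _; apply: leq_trans (leq_addl _ _).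
  by apply: pT.1; rewrite leq_addr.
rewrite /f; apply: (polytime_filter
  (p := fun y : (C * (seq bitseq * seq (seq bitseq))) * seq bitseq =>
    supplied pref (g y.1.1) (p y.1.1) (out y.1.1) y.1.2.2 y.2)); last by polytime_auto.
by apply: polytime_supplied; polytime_auto.
Qed.

Lemma polytime_stable_list (goals : C -> seq (seq bitseq)) (out : C -> seq bitseq)
    (x : C -> seq bitseq * (seq bitseq * seq bitseq)) :
  polytime goals -> polytime out -> polytime x ->
  polytime (fun c => stable_list pref (goals c) (out c) (x c)).
Proof.
move=> pgs po px.
pose g c := (x c).1; pose e c := (x c).2.1; pose p c := (x c).2.2.
have pg : polytime g by rewrite /g; polytime_auto.
have pe : polytime e by rewrite /e; polytime_auto.
have pp : polytime p by rewrite /p; polytime_auto.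
pose d c := demand pref (g c) (forced_list pref (g c) (p c) (out c) (goals c)).
have pd : polytime d by apply: polytime_demand => //; apply: polytime_forced_list.
apply: (@eq_polytime _ _ _ _ (fun c =>
  if good_list pref (goals c) (out c) (g c) then
    all (fun r => (count_mem r (out c) <= count_mem r (g c)) ||
                  (count_mem r (out c) <= count_mem r (d c))) (p c)
  else nilp (p c) && ~~ (included (g c) (out c ++ e c) && included (d c) (out c ++ e c)))).
  by move=> c; rewrite /d /g /e /p /stable_list; case: (x c) => ? [].
apply: polytime_if; [exact: polytime_good_list | | by polytime_lists].
apply: (polytime_all (p := fun y : C * bitseq =>
  (count_mem y.2 (out y.1) <= count_mem y.2 (g y.1)) ||
  (count_mem y.2 (out y.1) <= count_mem y.2 (d y.1)))); polytime_lists.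
Qed.

End CheckerCost.

Section CheckerCost.
Context {C : Type} {codC : codable C}.
Variable pref : preference.

Lemma polytime_equilibrium (players : C -> seq (seq bitseq * (seq bitseq * seq bitseq))) :
  polytime players -> polytime (fun c => equilibrium pref (players c)).
Proof.
move=> pps.
pose goals c := [seq x.1 | x <- players c].
pose out c := flatten [seq x.2.2 | x <- players c].
have pg : polytime goals.
  by apply: (polytime_map (f := fun y : C * (seq bitseq * (seq bitseq * seq bitseq)) => y.2.1)); polytime_auto.
have po : polytime out.
  apply: polytime_flatten.
  by apply: (polytime_map (f := fun y : C * (seq bitseq * (seq bitseq * seq bitseq)) => y.2.2.2)); polytime_auto.
apply: (polytime_all (p := fun y : C * (seq bitseq * (seq bitseq * seq bitseq)) =>
  stable_list pref (goals y.1) (out y.1) y.2)) => //.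
by apply: polytime_stable_list; polytime_auto.
Qed.

End CheckerCost.

Section CheckerCost.
Context {C : Type} {codC : codable C}.
Variable pref : preference.

Lemma polytime_all_of {A : Type} {codA : codable A} (p : A -> bool) (l : C -> seq A) :
  polytime p -> polytime l -> polytime (fun c => all p (l c)).
Proof.
by move=> pp pl; apply: (polytime_all (p := fun x => p x.2)) => //; polytime_auto.
Qed.

Lemma polytime_map_of {A B : Type} {codA : codable A} {codB : codable B} (f : A -> B)
    (l : C -> seq A) :
  polytime f -> polytime l -> polytime (fun c => [seq f x | x <- l c]).
Proof.
by move=> pf pl; apply: (polytime_map (f := fun x => f x.2)) => //; polytime_auto.
Qed.
End CheckerCost.

Lemma polytime_single : polytime (fun b : bundle_text => single b).
Proof. by rewrite /single; polytime_auto. Qed.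

Lemma polytime_valid_player : polytime (@valid_player bitseq).
Proof.
have ps := polytime_single; rewrite /valid_player.
by polytime_lists; apply: polytime_all_of => //; polytime_auto.
Qed.

Lemma polytime_summary : polytime (@summary bitseq).
Proof. by rewrite /summary; polytime_auto. Qed.

Lemma polytime_players : polytime (fun t : text => zip t.2.1 t.2.2).
Proof. by apply: polytime_zip; polytime_auto. Qed.

Lemma polytime_valid pref : polytime (valid pref).
Proof.
have pz := polytime_players; apply: polytime_andb.
  exact: (polytime_all_of polytime_valid_player pz).
by apply: polytime_equilibrium; apply: polytime_map_of => //; apply: polytime_summary.
Qed.

Lemma polytime_size {A C : Type} {codA : codable A} {codC : codable C} (l : C -> seq A) :
  polytime l -> polytime (fun c => size (l c)).
Proof.
move=> pl; apply: eq_polytime (polytime_count (p := fun=> true) (polytime_const true) pl).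
by move=> c; rewrite count_predT.
Qed.

Lemma polytime_well_formed : polytime well_formed.
Proof.
apply: polytime_andb.
  apply: (@eq_polytime _ _ _ _ (fun t : text =>
    (size t.2.1 <= size t.2.2) && (size t.2.2 <= size t.2.1))).
    by move=> t; rewrite eqn_leq.
  by polytime_auto; apply: polytime_size; polytime_auto.
apply: (polytime_all (p := fun x : text * ((bundle_text * bag_text) * bag_text) =>
  known x.1.1 x.2)); last exact: polytime_players.
apply: (polytime_all (p := fun y : (text * ((bundle_text * bag_text) * bag_text)) * bitseq =>
  y.2 \in y.1.1.1)); polytime_names.
Qed.

Lemma polytime_bracket {C : Type} {codC : codable C} (w : C -> seq symbol) :
  polytime w -> polytime (fun c => bracket (w c)).
Proof.
move=> pw; rewrite /bracket.
apply: (@eq_polytime _ _ _ _ (fun c => inr true :: (w c ++ [:: inr false]))).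
  by move=> c; rewrite cats1.
by polytime_auto.
Qed.

Lemma polytime_enc_list {A : Type} {codA : codable A} (enc : A -> seq symbol) :
  polytime enc -> polytime (enc_list enc).
Proof.
move=> pe; apply: polytime_bracket; apply: polytime_flatten.
exact: polytime_map_of pe polytime_id.
Qed.

Lemma polytime_write_text : polytime write_text.
Proof.
have pb : polytime write_bundle.
  apply: polytime_enc_list; apply: polytime_bracket; apply: polytime_map_of polytime_id.
  pose f (x : bool * bool) : symbol := if x.1 then inl x.2 else inr x.2.
  have pf : polytime f by apply: polytime_recode => -[[] b].
  by apply: (polytime_comp pf (g := fun b => (true, b))); polytime_auto.
have px : polytime write_bag by apply: polytime_enc_list.
have pn : polytime (enc_list enc_name) by exact: pb.
have pp : polytime (enc_list write_player).
  apply: polytime_enc_list; apply: polytime_bracket; polytime_auto.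
have pxs : polytime (enc_list write_bag) by apply: polytime_enc_list.
by rewrite /write_text; polytime_auto.
Qed.

Lemma polytime_item {C : Type} {codC : codable C} k (l : C -> seq sexp) :
  polytime l -> polytime (fun c => item k (l c)).
Proof.
move=> pl; apply: polytime_head; elim: k => [|k IH] //=.
exact: polytime_behead.
Qed.

Lemma polytime_read_text : polytime read_text.
Proof.
have pn : polytime read_name.
  by apply: polytime_map_of polytime_sexp_true _; polytime_auto.
have pb : polytime read_bundle by apply: polytime_map_of pn _; polytime_auto.
have px : polytime read_bag by apply: polytime_map_of pb _; polytime_auto.
have pp : polytime read_player.
  apply: polytime_pair; [apply: (polytime_comp pb) | apply: (polytime_comp px)];
  by apply: polytime_item; polytime_auto.
have pi k : polytime (fun l : seq sexp => items (item k l)).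
  by apply: polytime_items; apply: polytime_item; polytime_auto.
apply: polytime_pair; last apply: polytime_pair.
- exact: polytime_map_of pn (pi 0).
- exact: polytime_map_of pp (pi 1).
- exact: polytime_map_of px (pi 2).
Qed.

Definition symbol_bits (x : symbol) : bool * bool :=
  match x with inl b => (true, b) | inr b => (false, b) end.

Lemma polytime_symbol_bits : polytime symbol_bits.
Proof. exact: polytime_recode. Qed.

Lemma code_nested l : code (nested l) = code l.
Proof. by rewrite /code /codable_seq map_id. Qed.

Lemma polytime_parse_step :
  polytime (fun x : (seq sexp * seq (seq sexp)) * symbol => parse_step x.1 x.2).
Proof.
have pb := polytime_symbol_bits.
have pn : polytime nested := polytime_recode code_nested.
pose leaf (x : bool) := Atom (Some x).
have pl : polytime leaf by apply: polytime_recode.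
apply: (@eq_polytime _ _ _ _ (fun x : (seq sexp * seq (seq sexp)) * symbol =>
  if (symbol_bits x.2).1 then (leaf (symbol_bits x.2).2 :: x.1.1, x.1.2)
  else if (symbol_bits x.2).2 then (nested x.1.1 :: head [::] x.1.2, behead x.1.2)
  else ([::], x.1.1 :: x.1.2))).
  by case=> [[t r] [x|[]]].
by do 5?[polytime_auto; apply: polytime_head].
Qed.

(** A symbol only moves material between the current list and the unfinished ones and adds a bounded
    number of constructors, so constant growth suffices. *)
Lemma polytime_parse :
  polytime (fun u : seq symbol => foldl parse_step ([::], [::]) u).
Proof.
pose g (x : seq symbol * (symbol * (seq sexp * seq (seq sexp)))) := parse_step x.2.2 x.2.1.
apply: (polytime_fold_seq (g := g) (poly_const 4)).
- move=> c x [t r]; rewrite /g /parse_step /=.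
  have w0 (T : Type) (codT : codable T) : weight (code ([::] : seq T)) = 1 by [].
  case: x => [x|[]]; rewrite (weight_pair t r).
  + rewrite (weight_pair (Atom (Some x) :: t) r) (weight_cons (Atom (Some x)) t).
    have -> : weight (code (Atom (Some x))) = 1 by [].
    by lia.
  + rewrite (weight_pair (nested t :: head [::] r) (behead r)).
    rewrite (weight_cons (nested t) (head [::] r)) code_nested.
    by case: r => [|h r] /=; rewrite ?w0 ?(weight_cons h r); lia.
  + by rewrite (weight_pair ([::] : seq sexp) (t :: r)) (weight_cons t r) w0; lia.
- by rewrite /g; apply: (polytime_comp polytime_parse_step (g := fun x => (x.2.2, x.2.1))); polytime_auto.
- exact: polytime_id.
- exact: polytime_const.
Qed.

Lemma polytime_check_reversed pref : polytime (check_reversed pref).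
Proof.
pose t u := read_text (foldl parse_step ([::], [::]) u).1.
have pt : polytime t.
  by apply: (polytime_comp polytime_read_text); apply: polytime_fst_of; apply: polytime_parse.
have pw : polytime well_formed := polytime_well_formed.
have pv := polytime_valid pref.
have pe : polytime (fun u => write_text (t u) == rev u).
  apply: polytime_eq_seq.
  - apply: (@eq_polytime _ _ _ _ (fun x : symbol * symbol =>
      ((symbol_bits x.1).1 == (symbol_bits x.2).1) &&
      ((symbol_bits x.1).2 == (symbol_bits x.2).2))).
      by case=> [[x|x] [y|y]] //; case: x; case: y.
    by have ps := polytime_symbol_bits; polytime_auto.
  - exact: (polytime_comp polytime_write_text pt).
  - exact: polytime_rev polytime_id.
apply: polytime_andb; first exact: pe.
by apply: polytime_andb; [apply: (polytime_comp pw pt) | apply: (polytime_comp pv pt)].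
Qed.

Theorem theorem4 (pref : preference) : PTIME (NE_checking pref).
Proof. exact: polytime_PTIME (polytime_check_reversed pref) (check_reversedP pref). Qed.
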